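(* Let $f(X)=\langle Q,X^\top X\rangle$ on $\mathcal M(r,n)=(\mathrm{St}(d,r)\times\mathbb R^r)^n$ with $Q$ the connection Laplacian of a pose graph, and partition the $n$ poses into $N$ blocks, block $b$ containing $n_b$ poses, so that $\mathcal M(r,n)=\prod_{b=1}^N\mathcal M(r,n_b)$. Let $X^0\in\mathcal M(r,n)$, and run RBCD or RBCD++ (described in the context) from $X^0$ with $H=\operatorname{Hess}f_b$ (the Riemannian Hessian of the reduced cost) and with the initial trust-region radius $\Delta_0$ chosen sufficiently large. Then: 1. Within the sublevel set $\{X\in\mathcal M(r,n): f(X)\le f(X^0)\}$ there exist constants $c_b\ge0$ ($b\in[N]$) and $c_0\ge0$ such that for every $X$ in this set and every block $b$, with $f_b$ the reduced cost obtained by fixing the other blocks of $X$ and $\widehat f_b=f_b\circ\operatorname{Retr}_{X_b}$, $$\big|\widehat f_b(\eta_b)-[f_b(X_b)+\langle\eta_b,\operatorname{grad}f_b(X_b)\rangle]\big|\le\tfrac{c_b}{2}\|\eta_b\|^2\quad\forall\,\eta_b\in T_{X_b}\mathcal M(r,n_b),$$ $$\max_{\eta_b\in T_{X_b}\mathcal M(r,n_b),\,\|\eta_b\|\le1}|\langle\eta_b,\operatorname{Hess}f_b(X_b)[\eta_b]\rangle|\le c_0 .$$ 2. The iterates $X^k$ of RBCD and RBCD++ remain in this sublevel set, and consequently both algorithms retain their convergence guarantees. Namely, with $\lambda_b=\frac1{8(c_b+c_0)}$ and $f^\star$ the global minimum of $f$, the quantity $\min_{0\le k\le K-1}\|\operatorname{grad}f(X^k)\|^2$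 for greedy selection, and $\min_{0\le k\le K-1}\mathbb E_{b_{0:k-1}}\|\operatorname{grad}f(X^k)\|^2$ for uniform or importance sampling, is at most $\frac{4N(f(X^0)-f^\star)}{K\min_b\lambda_b}$ for RBCD and at most $\frac{N(f(X^0)-f^\star)}{CK}$ with $C=\min(c_1,\min_b\lambda_b/4)$ for RBCD++.
   Context: Pose graph: $d\in\{2,3\}$, a weakly connected directed graph $([n],\mathcal E)$ without self-loops, measurements $\widetilde R_{ij}\in\mathrm{SO}(d)$, $\widetilde t_{ij}\in\mathbb R^d$ and weights $\kappa_{ij},\tau_{ij}>0$ for $(i,j)\in\mathcal E$. With $\langle A,B\rangle=\operatorname{tr}(A^\top B)$, $Q$ is the unique symmetric $(d+1)n\times(d+1)n$ matrix such that for all $r$ and all $X=[Y_1\ p_1\cdots Y_n\ p_n]$, $Y_i\in\mathbb R^{r\times d}$, $p_i\in\mathbb R^r$: $\langle Q,X^\top X\rangle=\sum_{(i,j)\in\mathcal E}\kappa_{ij}\|Y_j-Y_i\widetilde R_{ij}\|_F^2+\tau_{ij}\|p_j-p_i-Y_i\widetilde t_{ij}\|_2^2$. $\mathrm{St}(d,r)=\{Y\in\mathbb R^{r\times d}:Y^\top Y=I_d\}$, $r\ge d$. All manifolds carry the metric induced from the ambient Euclidean space. The retraction is the product of a globally defined smooth retraction on each Stiefel factor and $p\mapsto p+\eta$ on each Euclidean factor. $\operatorname{grad}_bf$ is the component of $\operatorname{grad}f$ in block $b$. BlockUpdate$(f_b,X_b)$: start with $\Delta=\Delta_0$; repeat: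 compute an approximate minimizer $\eta_b^\star$ of the model $\widehat m_b(\eta_b)=f_b(X_b)+\langle\operatorname{grad}f_b(X_b),\eta_b\rangle+\frac12\langle\eta_b,H[\eta_b]\rangle$ over $\|\eta_b\|\le\Delta$ in $T_{X_b}$ (meaning $\|\eta_b^\star\|\le\Delta$ and model value no larger than that of the Cauchy step, the minimizer of $\widehat m_b$ along $-\operatorname{grad}f_b(X_b)$ within radius $\Delta$); if $\frac{\widehat f_b(0)-\widehat f_b(\eta_b^\star)}{\widehat m_b(0)-\widehat m_b(\eta_b^\star)}>\frac14$ return $\operatorname{Retr}_{X_b}(\eta_b^\star)$, else $\Delta\leftarrow\Delta/4$. A block with zero gradient is returned unchanged. RBCD: at iteration $k$ select a block $b_k$, set $X^{k+1}_{b_k}=$ BlockUpdate$(f_{b_k},X^k_{b_k})$, other blocks unchanged. RBCD++ with restart constant $c_1>0$: $V^0=X^0$, $\gamma_{-1}=0$. At iteration $k$: $\gamma_k=\frac{1+\sqrt{1+4N^2\gamma_{k-1}^2}}{2N}$, $\alpha_k=\frac1{\gamma_kN}$; $Y^k=\operatorname{Proj}_{\mathcal M}((1-\alpha_k)X^k+\alpha_kV^k)$ (projection of the ambient space onto the manifold); select $b_k$; $X^{k+1}_{b_k}=$ BlockUpdate$(f_{b_k},Y^k_{b_k})$ (other blocks fixed at $Y^k$), $X^{k+1}_{b'}=Y^k_{b'}$ for $b'\neq b_k$; $V^{k+1}=\operatorname{Proj}_{\mathcal M}(V^k+\gamma_k(X^{k+1}-Y^k))$. Restart: if $f(X^k)-f(X^{k+1})<c_1\|\operatorname{grad}_{b_k}f(X^k)\|^2$,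 replace $X^{k+1}$ by $X^{k+1}_{b_k}=$ BlockUpdate$(f_{b_k},X^k_{b_k})$ (other blocks fixed at $X^k$), $X^{k+1}_{b'}=X^k_{b'}$ for $b'\ne b_k$, and set $V^{k+1}=X^{k+1}$, $\gamma_k=0$. The calls of BlockUpdate at $Y^k$ are understood to return. Selection rules: uniform ($\Pr(b_k=b)=1/N$); importance ($\Pr(b_k=b)\propto\|\operatorname{grad}_bf(X^k)\|^2$); greedy ($b_k\in\arg\max_b\|\operatorname{grad}_bf(X^k)\|^2$). ''Sufficiently large'' means $\Delta_0\ge\lambda_b\|\operatorname{grad}f_b(X_b)\|$ for every input $X_b$ of BlockUpdate. Constants are taken so that $c_b+c_0>0$. *)

(* Defs.v *)
From mathcomp Require Import all_boot all_order all_algebra.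
From mathcomp Require Import boolp classical_sets reals topology normedtype.
From mathcomp Require Import derive.

Set Implicit Arguments.
Unset Strict Implicit.
Unset Printing Implicit Defensive.

Import Order.TTheory GRing.Theory Num.Theory.
Import numFieldNormedType.Exports.

Local Open Scope classical_set_scope.
Local Open Scope ring_scope.

Definition frob (R : realType) (m n : nat) (A B : 'M[R]_(m, n)) : R :=
  \tr (A^T *m B).

(* [Ck k U g]: the map g is of class C^k on the open set U. In finite
   dimension, g is C^(k+1) iff it is differentiable and all its directional
   derivatives are C^k. *)
Fixpoint Ck (R : realType) (V W : normedModType R) (k : nat) (U : set V)
    (g : V -> W) : Prop :=
  if k is k'.+1 then
    (forall x, U x -> differentiable g x) /\
    (forall v : V, Ck k' U (fun x => 'D_v g x))
  else forall x, U x -> {for x, continuous g}.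

(* A map on a subset of a vector space is smooth if it has local C^oo
   extensions to the ambient space; for an embedded submanifold this is the
   intrinsic notion. *)
Definition smooth_on (R : realType) (V W : normedModType R) (S : set V)
    (g : V -> W) : Prop :=
  forall x, S x -> exists (U : set V) (h : V -> W),
    [/\ open U, U x, (forall k, Ck k U h)
      & forall y, S y -> U y -> g y = h y].

Section Stiefel.
Variables (R : realType) (r d : nat).
Implicit Types Y V Z : 'M[R]_(r, d).

Definition stiefel Y : Prop := Y^T *m Y = 1%:M.

Definition stiefel_tangent Y V : Prop := Y^T *m V + V^T *m Y = 0.

(* Orthogonal projection on the tangent space at Y when Y is in the Stiefel
   manifold ([stiefel_tprojP]); a polynomial in (Y, Z), hence also defined for
   other Y. *)
Definition stiefel_tproj Y Z : 'M[R]_(r, d) :=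
  Z - Y *m (2^-1 *: (Y^T *m Z + Z^T *m Y)).

Definition smooth_retraction (rho : 'M[R]_(r, d) -> 'M[R]_(r, d) -> 'M[R]_(r, d))
    : Prop :=
  [/\ forall Y V, stiefel Y -> stiefel_tangent Y V -> stiefel (rho Y V),
      forall Y, stiefel Y -> rho Y 0 = Y,
      forall Y V, stiefel Y -> stiefel_tangent Y V ->
        is_derive (0 : R) (1 : R) (fun t : R => rho Y (t *: V)) V
    & smooth_on
        [set YV : 'M[R]_(r, d) * 'M[R]_(r, d) |
          stiefel YV.1 /\ stiefel_tangent YV.1 YV.2]
        (fun YV => rho YV.1 YV.2)].

End Stiefel.

Lemma stiefel_tprojP (R : realType) (r d : nat) (Y Z : 'M[R]_(r, d)) :
  stiefel Y ->
  stiefel_tangent Y (stiefel_tproj Y Z) /\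
  forall V, stiefel_tangent Y V -> frob V (Z - stiefel_tproj Y Z) = 0.
Proof.
rewrite /stiefel /stiefel_tangent /stiefel_tproj => Y1.
set S := 2^-1 *: _.
have ST : S^T = S by rewrite /S linearZ linearD /= !trmx_mul !trmxK addrC.
have SS : S + S = Y^T *m Z + Z^T *m Y.
  by rewrite -mulr2n -scaler_nat scalerA mulfV ?scale1r // pnatr_eq0.
split=> [|V tV].
  rewrite mulmxBr linearB /= mulmxBl trmx_mul ST mulmxA Y1 mul1mx -mulmxA Y1 mulmx1.
  by rewrite addrACA -SS -opprD subrr.
rewrite opprB addrCA subrr addr0 /frob mulmxA.
have VY : V^T *m Y = - (Y^T *m V) by apply/eqP; rewrite -addr_eq0 addrC tV.
set t := \tr _; suff : t + t = 0.
  by move/eqP; rewrite -mulr2n mulrn_eq0 /= => /eqP.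
have tE : t = - t.
  rewrite {1}/t -mxtrace_tr trmx_mul ST mxtrace_mulC trmx_mul trmxK.
  by rewrite -[Y^T *m V]opprK -VY mulNmx raddfN.
by rewrite {1}tE addNr.
Qed.

(* Ambient space of (St(d,r) x R^r)^I, for a finite set I of poses: the i-th
   component is the matrix [Y_i p_i]. *)
Notation config R r d I := {ffun I -> 'M[R]_(r, d + 1)} (only parsing).

Section Manifold.
Variables (R : realType) (r d : nat) (I : finType).
Implicit Types X V Z : config R r d I.
Implicit Types f : config R r d I -> R.

Definition dot X Z : R := \sum_i frob (X i) (Z i).
Definition nrm X : R := Num.sqrt (dot X X).

Definition manifold : set (config R r d I) :=
  [set X | forall i, stiefel (lsubmx (X i))].

Definition tangent X V : Prop :=
  forall i, stiefel_tangent (lsubmx (X i)) (lsubmx (V i)).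

Definition tproj X Z : config R r d I :=
  [ffun i => row_mx (stiefel_tproj (lsubmx (X i)) (lsubmx (Z i)))
                    (rsubmx (Z i))].

Definition egrad f X : config R r d I :=
  [ffun i => \matrix_(a, c)
    derive1 (fun t : R =>
      f (X + t *: [ffun j => if j == i then delta_mx a c else 0])) 0].

(* Riemannian gradient and Hessian of the restriction of f to the embedded
   submanifold: [rgrad f], given by a formula that makes sense at all ambient
   points, is the extension of the gradient field that is differentiated. *)
Definition rgrad f X : config R r d I := tproj X (egrad f X).

Definition rhess f X V : config R r d I :=
  tproj X [ffun i => derive1 (fun t : R => rgrad f (X + t *: V) i) 0].

(* P is a metric projection of Z on the manifold (it is not unique for
   exceptional Z). *)
Definition is_proj Z P : Prop :=
  manifold P /\ forall P', manifold P' -> nrm (Z - P) <= nrm (Z - P').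

End Manifold.

Section BlockUpdate.
Variables (R : realType) (r d : nat) (I : finType).
Variable rho : I -> 'M[R]_(r, d) -> 'M[R]_(r, d) -> 'M[R]_(r, d).
Variable f : config R r d I -> R.
Variable x : config R r d I.
Implicit Types eta s : config R r d I.

Definition retr eta : config R r d I :=
  [ffun i => row_mx (rho i (lsubmx (x i)) (lsubmx (eta i)))
                    (rsubmx (x i) + rsubmx (eta i))].

Definition pullback eta : R := f (retr eta).

Definition model eta : R :=
  f x + dot (rgrad f x) eta + 2^-1 * dot eta (rhess f x eta).

Definition cauchy_step (Delta : R) s : Prop :=
  let ray t := - (t *: rgrad f x) in
  (exists2 t, 0 <= t & s = ray t) /\ nrm s <= Delta /\
  (forall t, 0 <= t -> nrm (ray t) <= Delta -> model s <= model (ray t)).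

Definition approx_minimizer (Delta : R) eta : Prop :=
  [/\ tangent x eta, nrm eta <= Delta
    & exists2 s, cauchy_step Delta s & model eta <= model s].

Definition accepted eta : Prop :=
  4^-1 < (pullback 0 - pullback eta) / (model 0 - model eta).

(* [tr_loop Delta x']: the loop, entered with radius Delta, may return x'. The
   choice of the approximate minimizers is left open. *)
Inductive tr_loop (Delta : R) (x' : config R r d I) : Prop :=
| tr_return eta of approx_minimizer Delta eta & accepted eta & x' = retr eta
| tr_shrink eta of approx_minimizer Delta eta & ~ accepted eta
    & tr_loop (Delta / 4) x'.

(* The loop terminates for all choices of the approximate minimizers. *)
Inductive tr_terminates (Delta : R) : Prop :=
| TrTerminates of (forall eta, approx_minimizer Delta eta -> ~ accepted eta ->
    tr_terminates (Delta / 4)).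

Definition block_update (Delta0 : R) (x' : config R r d I) : Prop :=
  (rgrad f x = 0 /\ x' = x) \/ (rgrad f x <> 0 /\ tr_loop Delta0 x').

Definition block_update_terminates (Delta0 : R) : Prop :=
  rgrad f x <> 0 -> tr_terminates Delta0.

End BlockUpdate.

Record pose_graph (R : realType) (d n : nat) := PoseGraph {
  edge : rel 'I_n;
  meas_rot : 'I_n -> 'I_n -> 'M[R]_d;
  meas_trans : 'I_n -> 'I_n -> 'cV[R]_d;
  kappa : 'I_n -> 'I_n -> R;
  tau : 'I_n -> 'I_n -> R;
  edge_irrefl : forall i, ~~ edge i i;
  edge_weakly_connected :
    forall i j, connect [rel k l | edge k l || edge l k] i j;
  meas_rot_SO : forall i j, edge i j ->
    (meas_rot i j)^T *m meas_rot i j = 1%:M /\ \det (meas_rot i j) = 1;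
  kappa_gt0 : forall i j, edge i j -> 0 < kappa i j;
  tau_gt0 : forall i j, edge i j -> 0 < tau i j }.

Definition concat (R : realType) (r d n : nat) (X : config R r d 'I_n) :
  'M[R]_(r, \sum_(i < n) (d + 1)) := \mxrow_(i < n) X i.

Definition is_connection_laplacian (R : realType) (d n : nat)
    (G : pose_graph R d n) (Q : 'M[R]_(\sum_(i < n) (d + 1))) : Prop :=
  Q^T = Q /\
  forall (r : nat) (X : config R r d 'I_n),
    let Y i := lsubmx (X i) in
    let p i := rsubmx (X i) in
    let sqr m (A : 'M[R]_(r, m)) := frob A A in
    frob Q ((concat X)^T *m concat X) =
    \sum_(e : 'I_n * 'I_n | edge G e.1 e.2)
      (kappa G e.1 e.2 * sqr d (Y e.2 - Y e.1 *m meas_rot G e.1 e.2)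
       + tau G e.1 e.2 * sqr 1%N (p e.2 - p e.1 - Y e.1 *m meas_trans G e.1 e.2)).

Lemma connection_laplacian_exists (R : realType) (d n : nat)
    (G : pose_graph R d n) :
  exists Q, is_connection_laplacian G Q.
Proof.
pose P m (i : 'I_n) (B : 'M[R]_(d + 1, m)) : 'M[R]_(\sum_(i < n) (d + 1), m) :=
  \mxcol_(k < n) (if k == i then B else 0).
have PE r (X : {ffun 'I_n -> 'M[R]_(r, d + 1)}) m i B : concat X *m P m i B = X i *m B.
  rewrite /concat mul_mxrow_mxcol (bigD1 i) //= eqxx big1 ?addr0 // => j /negPf ->.
  by rewrite mulmx0.
pose A e := P d e.2 (col_mx 1%:M 0) - P d e.1 (col_mx (meas_rot G e.1 e.2) 0).
pose B e := P 1%N e.2 (col_mx 0 1%:M) - P 1%N e.1 (col_mx 0 1%:M) - P 1%N e.1 (col_mx (meas_trans G e.1 e.2) 0).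
exists (\sum_(e : 'I_n * 'I_n | edge G e.1 e.2)
  (kappa G e.1 e.2 *: (A e *m (A e)^T) + tau G e.1 e.2 *: (B e *m (B e)^T))).
have H m (M : 'M[R]_(_, m)) : (M *m M^T)^T = M *m M^T by rewrite trmx_mul trmxK.
have sym e : (kappa G e.1 e.2 *: (A e *m (A e)^T) + tau G e.1 e.2 *: (B e *m (B e)^T))^T = kappa G e.1 e.2 *: (A e *m (A e)^T) + tau G e.1 e.2 *: (B e *m (B e)^T).
  by rewrite linearD !linearZ /= !H.
split; first by rewrite raddf_sum; apply: eq_bigr => e _; exact: sym.
move=> r X /=; rewrite /frob [(\sum_(e | _) _)^T]raddf_sum mulmx_suml raddf_sum; apply: eq_bigr => e _.
rewrite [X in X *m _]sym mulmxDl -!scalemxAl [LHS]linearD [X in X + _ = _]linearZ [X in _ + X = _]linearZ /=.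
have T m (M : 'M[R]_(_, m)) : \tr (M *m M^T *m ((concat X)^T *m concat X)) = \tr ((concat X *m M)^T *m (concat X *m M)).
  by rewrite -mulmxA mxtrace_mulC trmx_mul !mulmxA.
have XE i : X i = row_mx (lsubmx (X i)) (rsubmx (X i)) by rewrite hsubmxK.
rewrite !T; congr (_ * _ + _ * _); rewrite /A /B ?mulmxBr !PE (XE e.1) (XE e.2) !mul_row_col !mulmx0 !mulmx1 ?add0r ?addr0 !row_mxKl ?row_mxKr //.
Qed.

Definition cost (R : realType) (r d n : nat)
    (Q : 'M[R]_(\sum_(i < n) (d + 1))) (X : config R r d 'I_n) : R :=
  frob Q ((concat X)^T *m concat X).

(* [blk i] is the block of pose i. *)

Section Blocks.
Variables (R : realType) (r d n N : nat) (blk : 'I_n -> 'I_N).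
Implicit Types X : config R r d 'I_n.

Definition block (b : 'I_N) : finType := {i : 'I_n | blk i == b}.

Definition restr (b : 'I_N) X : config R r d (block b) :=
  [ffun j => X (val j)].

Definition merge (b : 'I_N) X (Z : config R r d (block b)) :
  config R r d 'I_n :=
  [ffun i => if (insub i : option (block b)) is Some j then Z j else X i].

Definition reduced (f : config R r d 'I_n -> R) (b : 'I_N) X :
  config R r d (block b) -> R := fun Z => f (merge X Z).

Definition grad_block (f : config R r d 'I_n -> R) (b : 'I_N) X :
  config R r d (block b) := restr b (rgrad f X).

End Blocks.

Arguments restr {R r d n N} blk b X.
Arguments reduced {R r d n N} blk f b X Z.
Arguments grad_block {R r d n N} blk f b X.

Section Algorithms.
Variables (R : realType) (r d n N : nat) (blk : 'I_n -> 'I_N).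
Variable rho : 'I_n -> 'M[R]_(r, d) -> 'M[R]_(r, d) -> 'M[R]_(r, d).
Variable f : config R r d 'I_n -> R.
Variable X0 : config R r d 'I_n.
Implicit Types X Y V : config R r d 'I_n.

Definition sublevel : set (config R r d 'I_n) :=
  [set X | manifold X /\ f X <= f X0].

Definition block_rho (b : 'I_N) (j : block blk b) := rho (val j).

Definition admissible (c : 'I_N -> R) (c0 : R) : Prop :=
  [/\ forall b, 0 <= c b, 0 <= c0, forall b, 0 < c b + c0
    & forall X, sublevel X -> forall b : 'I_N,
      let fb := reduced blk f b X in
      let Xb := restr blk b X in
      (forall eta, tangent Xb eta ->
        `| pullback (@block_rho b) fb Xb eta
           - (fb Xb + dot eta (rgrad fb Xb)) | <= c b / 2 * nrm eta ^+ 2) /\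
      (forall eta, tangent Xb eta -> nrm eta <= 1 ->
        `| dot eta (rhess fb Xb eta) | <= c0)].

Definition terminates_at (Delta0 : R) (b : 'I_N) X : Prop :=
  block_update_terminates (@block_rho b) (reduced blk f b X) (restr blk b X)
    Delta0.

(* A call of BlockUpdate on block b of X that returns, the other blocks being
   fixed at X, with resulting point X'. The radius Delta0 is sufficiently large
   for its input. *)
Definition call (lam : 'I_N -> R) (Delta0 : R) (b : 'I_N) X X' : Prop :=
  let fb := reduced blk f b X in
  let Xb := restr blk b X in
  lam b * nrm (rgrad fb Xb) <= Delta0 /\
  exists2 z, block_update (@block_rho b) fb Xb Delta0 z & X' = merge X z.

Definition rbcd_step (lam : 'I_N -> R) (Delta0 : R) X (b : 'I_N) X' : Prop :=
  call lam Delta0 b X X'.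

(* [pp_gamma] is gamma_(k-1) in the state at the start of iteration k. *)
Record pp_state := PPState {
  pp_X : config R r d 'I_n;
  pp_V : config R r d 'I_n;
  pp_gamma : R }.

Definition pp_init : pp_state := PPState X0 X0 0.

Definition rbcdpp_step (c1 : R) (lam : 'I_N -> R) (Delta0 : R)
    (s : pp_state) (b : 'I_N) (s' : pp_state) : Prop :=
  let X := pp_X s in
  let V := pp_V s in
  let gamma :=
    (1 + Num.sqrt (1 + 4 * N%:R ^+ 2 * pp_gamma s ^+ 2)) / (2 * N%:R) in
  let alpha := (gamma * N%:R)^-1 in
  exists Y X1 V1,
    [/\ is_proj ((1 - alpha) *: X + alpha *: V) Y,
        call lam Delta0 b Y X1,
        is_proj (V + gamma *: (X1 - Y)) V1
      & if f X - f X1 < c1 * nrm (grad_block blk f b X) ^+ 2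
        then [/\ call lam Delta0 b X (pp_X s'), pp_V s' = pp_X s'
               & pp_gamma s' = 0]
        else s' = PPState X1 V1 gamma].

(* Runs of an algorithm with states S, started at s0, whose current point is
   [cur s]. *)
Section Runs.
Variables (S : Type) (step : S -> 'I_N -> S -> Prop) (s0 : S).
Variable cur : S -> config R r d 'I_n.

Definition is_run (b : nat -> 'I_N) (s : nat -> S) : Prop :=
  s 0%N = s0 /\ forall k, step (s k) (b k) (s k.+1).

Definition stays_in_sublevel : Prop :=
  forall b s, is_run b s -> forall k, sublevel (cur (s k)).

Definition greedy (b : nat -> 'I_N) (s : nat -> S) : Prop :=
  forall k b', nrm (grad_block blk f b' (cur (s k))) ^+ 2
    <= nrm (grad_block blk f (b k) (cur (s k))) ^+ 2.

Definition min_upto (K : nat) (u : nat -> R) : R :=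
  \big[Num.min/u 0%N]_(k < K) u k.

Definition greedy_rate (bound : nat -> R) : Prop :=
  forall b s, is_run b s -> greedy b s -> forall K, (0 < K)%N ->
    min_upto K (fun k => nrm (rgrad f (cur (s k))) ^+ 2) <= bound K.

(* Random selection: [p h b] is the conditional probability of b_k = b given
   the previous selections h = (b_0, ..., b_(k-1)), and [prob p h] is the
   probability of h. *)
Definition prob (p : seq 'I_N -> 'I_N -> R) (h : seq 'I_N) : R :=
  (fix go pre h := if h is b :: h' then p pre b * go (rcons pre b) h' else 1)
    [::] h.

Definition expect (p : seq 'I_N -> 'I_N -> R) (k : nat) (u : seq 'I_N -> R) : R :=
  \sum_(h : k.-tuple 'I_N) prob p h * u h.

(* The state is a function of the past selections; it is unconstrained after
   selections of probability 0. *)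
Definition is_random_run (p : seq 'I_N -> 'I_N -> R) (s : seq 'I_N -> S) : Prop :=
  s [::] = s0 /\
  forall h b, 0 < prob p (rcons h b) -> step (s h) b (s (rcons h b)).

Definition uniform (p : seq 'I_N -> 'I_N -> R) : Prop :=
  forall h b, p h b = N%:R^-1.

(* The distribution is arbitrary if all block gradients vanish. *)
Definition importance (p : seq 'I_N -> 'I_N -> R) (s : seq 'I_N -> S) : Prop :=
  forall h,
    [/\ forall b, 0 <= p h b, \sum_b p h b = 1
      & forall b, p h b * \sum_b' nrm (grad_block blk f b' (cur (s h))) ^+ 2
          = nrm (grad_block blk f b (cur (s h))) ^+ 2].

Definition random_rate (bound : nat -> R) : Prop :=
  forall p s, is_random_run p s -> uniform p \/ importance p s ->
  forall K, (0 < K)%N ->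
    min_upto K (fun k => expect p k (fun h => nrm (rgrad f (cur (s h))) ^+ 2))
    <= bound K.

End Runs.

End Algorithms.

(* Main.v *)
(* In each block the cost is a quadratic function. As it is a sum of squares,
   |2 <Q X, Z>| <= f X + f Z, which bounds its gradient on the sublevel set. A
   smooth retraction satisfies Retr_Y(V) = Y + V + O(|V|^2) with a uniform
   constant: near the zero section by Taylor's formula and compactness of the
   Stiefel manifold, far from it because both Retr_Y(V) and Y have bounded
   entries. Together these give c_b and c_0.

   In BlockUpdate write g for the gradient. A step rejected at radius Delta
   forces Delta >= 6 lambda |g|: for a smaller radius the decrease of the model,
   at least Delta |g| - c_0 Delta^2 / 2, dominates the model error
   (c_b + c_0) Delta^2 / 2. Hence the loop stops, at a radius that is at least
   lambda |g|, and then the cost drops by at least lambda |g|^2 / 4. With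
   RBCD++ the restart test yields the same with C in place of lambda / 4. The
   rates follow by telescoping, as each selection rule satisfies
   E |grad_b f|^2 >= |grad f|^2 / N; for importance sampling this is
   Cauchy-Schwarz. *)

Require Import Defs.
From mathcomp Require Import all_boot all_order all_algebra.
From mathcomp Require Import boolp classical_sets reals topology normedtype.
From mathcomp Require Import derive.
From mathcomp Require Import functions ring lra.

Set Implicit Arguments.
Unset Strict Implicit.
Unset Printing Implicit Defensive.

Import Order.TTheory GRing.Theory Num.Theory.
Import numFieldNormedType.Exports.

Local Open Scope classical_set_scope.
Local Open Scope ring_scope.

(** * Retractions *)

Lemma mx_norm_le (R : realType) (m n : nat) (A : 'M[R]_(m, n)) (K : R) :
  0 <= K -> (forall i j, `|A i j| <= K) -> `|A| <= K.
Proof.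
move=> K0 AK; rewrite [leLHS]/Num.Def.normr /= mx_normrE.
by apply: bigmax_le => [|[i j] _]; [exact: K0|exact: AK].
Qed.

Lemma le_mx_norm (R : realType) (m n : nat) (A : 'M[R]_(m, n)) i j :
  `|A i j| <= `|A|.
Proof.
rewrite [leRHS]/Num.Def.normr /= mx_normrE.
exact: (le_bigmax _ (fun p : 'I_m * 'I_n => `|A p.1 p.2|) (i, j)).
Qed.

(** The mean value theorem is applied twice, to [phi] on [0,1] and to [phi1] on [0,c]. The factor
    1/2 of Taylor's formula is lost, which only enlarges constants. *)
Lemma taylor_bound (R : realType) (phi phi1 phi2 : R -> R) (B : R) :
  (forall t : R, t \in `[0, 1] -> is_derive t 1 phi (phi1 t)) ->
  (forall t : R, t \in `[0, 1] -> is_derive t 1 phi1 (phi2 t)) ->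
  (forall t : R, t \in `[0, 1] -> `|phi2 t| <= B) ->
  `|phi 1 - phi 0 - phi1 0| <= B.
Proof.
move=> d1 d2 bd.
have mvt (a : R) (p p' : R -> R) : 0 <= a <= 1 ->
    (forall t : R, t \in `[0, 1] -> is_derive t 1 p (p' t)) ->
    exists2 c, c \in `[0, a] & p a - p 0 = p' c * a.
  move=> /andP[a0 a1] dp.
  have sub t : t \in `[0, a] -> t \in `[0, 1].
    by rewrite !in_itv /= => /andP[-> /le_trans->].
  have d' x : x \in `]0, a[ -> is_derive x 1 p (p' x).
    move=> xa; apply/dp/sub; move: xa; rewrite !in_itv /= => /andP[? ?].
    by rewrite !ltW.
  have cp : {within `[0, a], continuous p}.
    apply: derivable_within_continuous => t ta.
    by have := dp t (sub _ ta); case.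
  by have [c ca e] := MVT_segment a0 d' cp; exists c; rewrite // e subr0.
have [|c c01 ->] := mvt 1 phi phi1 _ d1; first by rewrite ler01 lexx.
rewrite mulr1; have := c01; rewrite in_itv /= => c01'.
have [x xc ->] := mvt c phi1 phi2 c01' d2.
have x01 : x \in `[0, 1].
  move: xc c01'; rewrite !in_itv /= => /andP[-> xc] /andP[_ c1].
  exact: le_trans c1.
case/andP: c01' => c0 c1.
rewrite normrM (ger0_norm c0) -[leRHS]mulr1.
by apply: ler_pM => //; exact: bd.
Qed.

Lemma is_derive_line (R : realType) (V W : normedModType R) (h : V -> W)
    (x v : V) (t : R) :
  differentiable h (x + t *: v) ->
  is_derive t 1 (fun s : R => h (x + s *: v)) ('D_v h (x + t *: v)).
Proof.
move=> dh; rewrite deriveE //.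
have dl : is_diff t (cst x + ( *:%R^~ v)) (0 + ( *:%R^~ v)).
  exact: is_diffD.
have dlt : differentiable (cst x + ( *:%R^~ v)) t by case: dl.
have dc : differentiable (h \o (cst x + ( *:%R^~ v))) t.
  exact: differentiable_comp.
apply: DeriveDef; first exact: diff_derivable dc.
rewrite -[fun s => _]/(h \o (cst x + ( *:%R^~ v))) deriveE // diff_comp //=.
by case: dl => _ ->; rewrite /= add0r scale1r.
Qed.

Section SecondOrder.
Variables (R : realType) (V : normedModType R) (m n : nat).
Variables (h : V -> 'M[R]_(m, n)) (U : set V) (x0 : V).
Variables (J : finType) (e : J -> V).
Hypotheses (openU : open U) (Ux0 : U x0) (C2h : Ck 2 U h).

(* [Ck] only speaks of derivatives in fixed directions, so the second order
   bound is uniform over combinations of finitely many of them, in terms of the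
   coordinates. *)
Let comb (c : J -> R) : V := \sum_j c j *: e j.

Lemma derive_comb (W : normedModType R) (g : V -> W) (c : J -> R) (y : V) :
  differentiable g y -> 'D_(comb c) g y = \sum_j c j *: 'D_(e j) g y.
Proof.
move=> dg; rewrite deriveE // linear_sum; apply: eq_bigr => j _.
by rewrite linearZ /= deriveE.
Qed.

(** The second derivatives along pairs [e i], [e j] are continuous, hence bounded near [x0]. Along
    the segment from [x] to [x + comb c] the second derivative is their combination with
    coefficients [c i * c j]. *)
Lemma local_second_order : exists (eps C : R), 0 < eps /\
  forall (x : V) (c : J -> R) (B : R), ball x0 eps x -> ball x0 eps (x + comb c) ->
    (forall j, `|c j| <= B) ->
    `|h (x + comb c) - h x - 'D_(comb c) h x| <= C * B ^+ 2.
Proof.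
case: C2h => dh C1h.
have d1h v y : U y -> differentiable (fun x => 'D_v h x) y.
  by case: (C1h v) => + _; apply.
have ch v w y : U y -> {for y, continuous (fun x => 'D_w (fun x => 'D_v h x) x)}.
  by case: (C1h v) => _ /(_ w); apply.
pose D i j x := 'D_(e i) (fun x => 'D_(e j) h x) x.
(* The summand 1 makes [M] a strict bound at [x0] for all pairs at once, so that it persists nearby
   by continuity. *)
pose M := 1 + \sum_i \sum_j `|D i j x0|.
have nearM : \forall x \near x0, forall p : J * J, `|D p.1 p.2 x| <= M.
  apply: filter_forall => -[i j] /=.
  have lt : `|D i j x0| < M; last exact: cvgr_norm_le (ch (e j) (e i) x0 Ux0) _ lt.
  rewrite ltr_pwDl ?ltr01 //; apply: (@le_trans _ _ (\sum_k `|D i k x0|)).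
    by rewrite (bigD1 j isT) lerDl; apply: sumr_ge0 => k _; exact: normr_ge0.
  rewrite [leRHS](bigD1 i isT) lerDl.
  by apply: sumr_ge0 => k _; apply: sumr_ge0 => l _; exact: normr_ge0.
have : nbhs x0 (U `&` [set x | forall p : J * J, `|D p.1 p.2 x| <= M]).
  by apply: filterI => //; exact: open_nbhs_nbhs.
rewrite -nbhs_ballE => -[eps /= eps0 sub].
exists eps, (\sum_(j : J) \sum_(i : J) M); split => // x c B bx bxv cB.
set v := comb c.
have M0 : 0 <= M by rewrite addr_ge0 // sumr_ge0 // => i _; exact: sumr_ge0.
have bt (t : R) : t \in `[0, 1] -> ball x0 eps (x + t *: v).
  rewrite in_itv /= => /andP[t0 t1].
  move: bx bxv; rewrite -ball_normE /= => bx bxv.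
  have -> : x0 - (x + t *: v) = (1 - t) *: (x0 - x) + t *: (x0 - (x + v)).
    by rewrite !opprD !addrA scalerBl scale1r [t *: (_ - v)]scalerBr addrA subrK.
  (* Strictness comes from the summand with factor [t], so [t = 0] is treated apart. *)
  have [->|tn0] := eqVneq t 0; first by rewrite subr0 scale1r scale0r addr0.
  have tp : 0 < t by rewrite lt_neqAle eq_sym tn0.
  apply: le_lt_trans (ler_normD _ _) _; rewrite !normrZ (ger0_norm t0) ger0_norm ?subr_ge0 //.
  apply: (@lt_le_trans _ _ ((1 - t) * eps + t * eps)); last by rewrite -mulrDl subrK mul1r.
  by apply: ler_ltD; [apply: ler_wpM2l; rewrite ?subr_ge0 // ltW|rewrite ltr_pM2l].
have DM (t : R) i j : t \in `[0, 1] -> `|D i j (x + t *: v)| <= M.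
  by move=> /bt /sub[_ /(_ (i, j))].
have Ut (t : R) : t \in `[0, 1] -> U (x + t *: v) by move=> /bt /sub[].
apply: mx_norm_le => [|a b].
  by apply: mulr_ge0; rewrite ?sqr_ge0 // sumr_ge0 // => i _; rewrite sumr_ge0.
(* The mean value theorem is scalar, so the estimate is made entry by entry. *)
pose phi (t : R) : R := h (x + t *: v) a b.
pose phi1 (t : R) : R := (\sum_j c j *: 'D_(e j) h (x + t *: v)) a b.
pose phi2 (t : R) : R := (\sum_j c j *: (\sum_i c i *: D i j (x + t *: v))) a b.
have is_coord (g : R -> 'M[R]_(m, n)) (t : R) (l : 'M[R]_(m, n)) :
    is_derive t 1 g l -> is_derive t 1 (fun t : R => g t a b : R) (l a b).
  case=> dg <-; have /derivable_mxP/(_ a b) dgab := dg.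
  by rewrite derive_mx // mxE; apply/derivableP.
have -> : (h (x + v) - h x - 'D_v h x) a b = phi 1 - phi 0 - phi1 0.
  rewrite /phi /phi1 scale1r scale0r addr0 -derive_comb ?mxE //.
  by apply: dh; have := @Ut 0; rewrite scale0r addr0; apply; rewrite in_itv /= lexx ler01.
apply: (@taylor_bound R phi phi1 phi2) => t t01.
- apply: is_coord; rewrite -derive_comb; first by apply: is_derive_line; apply/dh/Ut.
  exact/dh/Ut.
- apply: is_coord.
  rewrite (_ : (fun s => _) = \sum_j (fun s => c j *: 'D_(e j) h (x + s *: v))); last first.
    by apply/funext => s; rewrite fct_sumE.
  elim/big_ind2 : _ => [|? ? ? ? ? ?|j _]; [exact: is_derive_cst|exact: is_deriveD|].
  apply: is_deriveZ; rewrite -derive_comb; first by apply: is_derive_line; apply/d1h/Ut.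
  exact/d1h/Ut.
rewrite /phi2 summxE mulr_suml; apply: le_trans (ler_norm_sum _ _ _) _.
apply: ler_sum => j _; rewrite mxE summxE normrM mulr_suml.
rewrite expr2 -mulr_suml mulrCA. 
apply: ler_pM => //; apply: le_trans (ler_norm_sum _ _ _) _.
rewrite mulr_suml; apply: ler_sum => i _; rewrite mxE normrM mulrC.
apply: ler_pM => //; apply: le_trans (DM t i j t01).
exact: le_mx_norm.
Unshelve. all: by end_near.
Qed.

End SecondOrder.

(** The diagonal of [Y^T *m Y] says that the columns are unit vectors; [|Y|] is the largest absolute
    value of an entry. *)
Lemma stiefel_norm_le1 (R : realType) (r d : nat) (Y : 'M[R]_(r, d)) :
  stiefel Y -> `|Y| <= 1.
Proof.
move=> YY; apply: mx_norm_le => // i j.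
rewrite -(@expr_le1 _ 2) // real_normK ?num_real //.
have := congr1 (fun M : 'M[R]_d => M j j) YY; rewrite mxE [RHS]mxE eqxx mulr1n => <-.
rewrite (bigD1 i isT) /= mxE expr2 lerDl.
by apply: sumr_ge0 => k _; rewrite mxE -expr2 sqr_ge0.
Qed.

Lemma stiefel_tangentZ (R : realType) (r d : nat) (Y V : 'M[R]_(r, d)) t :
  stiefel_tangent Y V -> stiefel_tangent Y (t *: V).
Proof.
rewrite /stiefel_tangent => tV; rewrite -scalemxAr.
by rewrite [(t *: V)^T]linearZ -scalemxAl -scalerDr tV scaler0.
Qed.

Lemma stiefel_tangent0 (R : realType) (r d : nat) (Y : 'M[R]_(r, d)) :
  stiefel_tangent Y 0.
Proof. by rewrite /stiefel_tangent mulmx0 trmx0 mul0mx addr0. Qed.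

(** Phrased with row vectors so that Heine-Borel applies: entries are bounded by 1, and the set is
    cut out by finitely many polynomial equations. *)
Lemma stiefel_compact (R : realType) (r d : nat) :
  compact [set v : 'rV[R]_(r * d) | stiefel (vec_mx v : 'M[R]_(r, d))].
Proof.
apply: bounded_closed_compact.
  exists 1; split => // M M1 v /= /stiefel_norm_le1 v1.
  apply: mx_norm_le => [|i j]; first by rewrite ltW // (lt_trans ltr01).
  rewrite (ord1 i); case/mxvec_indexP: j => a b.
  have -> : v 0 (mxvec_index a b) = (vec_mx v : 'M[R]_(r, d)) a b by rewrite mxE.
  by rewrite (le_trans (le_mx_norm _ _ _)) // (le_trans v1) // ltW.
rewrite (_ : mkset _ = \bigcap_(p in [set: 'I_d * 'I_d])
   ((fun v : 'rV[R]_(r * d) => \sum_k v 0 (mxvec_index k p.1) * v 0 (mxvec_index k p.2))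
      @^-1` [set (1%:M : 'M[R]_d) p.1 p.2])).
  apply: closed_bigI => p _; apply: preimage_closed; last exact: closed_eq.
  move=> v _; apply: continuous_big => [|k _ {}v]; first exact: add_continuous.
  by apply: continuousM; exact: coord_continuous.
apply/seteqP; split => v /=.
  move=> vS p _ /=; rewrite -vS mxE; apply: eq_bigr => k _.
  by rewrite !mxE.
move=> vS; apply/matrixP => i j; rewrite -(vS (i, j) I) mxE.
by apply: eq_bigr => k _; rewrite !mxE.
Qed.

Section RetractionBound.
Variables (R : realType) (r d : nat).
Variable rho : 'M[R]_(r, d) -> 'M[R]_(r, d) -> 'M[R]_(r, d).
Hypothesis hrho : smooth_retraction rho.

(** The second-order bound is applied to a smooth extension [h] of the retraction near [(Y0, 0)], in
    the directions [(0, V)] only: there [h (Y, 0) = Y], and the first-order term is [V]. *)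
Lemma retraction_local_bound Y0 : stiefel Y0 -> exists (eps C : R), 0 < eps /\
  forall Y V, stiefel Y -> stiefel_tangent Y V -> ball Y0 eps Y -> `|V| < eps ->
    `|rho Y V - Y - V| <= C * `|V| ^+ 2.
Proof.
case: hrho => _ rho0 drho srho Y0S.
have x0S : [set YV : 'M[R]_(r, d) * 'M[R]_(r, d) |
    stiefel YV.1 /\ stiefel_tangent YV.1 YV.2] (Y0, 0).
  by split => //=; exact: stiefel_tangent0.
have [U [h [oU Ux0 Ckh hE]]] := srho _ x0S.
pose e (p : 'I_r * 'I_d) : 'M[R]_(r, d) * 'M[R]_(r, d) := (0, delta_mx p.1 p.2).
have [e1 [C [e10 bnd]]] := local_second_order e oU Ux0 (Ckh 2%N).
have : nbhs (Y0, 0 : 'M[R]_(r, d)) U by exact: open_nbhs_nbhs.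
rewrite -nbhs_ballE => -[e2 /= e20 sub].
exists (Num.min e1 e2), C; split; first by rewrite lt_min e10.
move=> Y V YS tV YY0 Vs.
have combE : \sum_p V p.1 p.2 *: e p = (0, V).
  apply: (@etrans _ _ (\sum_p (0 : 'M[R]_(r, d), V p.1 p.2 *: delta_mx p.1 p.2))).
    by apply: eq_bigr => p _; rewrite /e; congr pair; rewrite /= scaler0.
  have M : {morph (fun W : 'M[R]_(r, d) => (0 : 'M[R]_(r, d), W)) : x y / x + y}.
    by move=> x y; congr pair; rewrite /= addr0.
  rewrite -(big_morph _ M (erefl _)); congr pair.
  by rewrite [RHS]matrix_sum_delta pair_big.
have b0 : ball (0 : 'M[R]_(r, d)) (Num.min e1 e2) V.
  by rewrite -ball_normE /= sub0r normrN.
have inb (e3 : R) (W : 'M[R]_(r, d)) : Num.min e1 e2 <= e3 -> `|W| <= `|V| ->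
    ball (Y0, 0 : 'M[R]_(r, d)) e3 (Y, W).
  move=> le3 WV; split => /=; first exact: le_ball YY0.
  by rewrite -ball_normE /= sub0r normrN (le_lt_trans WV) // (lt_le_trans Vs).
have UW W : `|W| <= `|V| -> U (Y, W).
  by move=> WV; apply: sub; apply: inb => //; rewrite ge_min lexx orbT.
have hW W : stiefel_tangent Y W -> `|W| <= `|V| -> rho Y W = h (Y, W).
  by move=> tW WV; rewrite -(hE (Y, W)) //=; exact: UW.
have addE (t : R) : (Y, 0) + t *: (0, V) = (Y, t *: V).
  by congr pair; rewrite /= ?scaler0 ?addr0 ?add0r.
have := bnd (Y, 0) (fun p => V p.1 p.2) `|V|.
rewrite combE -[(0, V)]scale1r addE !scale1r.
(* [h] agrees with [rho] only on the tangent bundle, but the line of the points [(Y, t *: V)] stays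
   in it, so the derivative along this line is the one prescribed for a retraction. *)
have dh : 'D_(0, V) h (Y, 0) = V.
  have dif : differentiable h ((Y, 0) + (0 : R) *: (0, V)).
    rewrite scale0r addr0; have [+ _] := Ckh 1%N; apply; apply: UW.
    by rewrite normr0.
  have D1 := is_derive_line dif.
  have [d2 v2] := drho Y V YS tV.
  have [d1 v1] := D1.
  rewrite -[(Y, 0)]addr0 -[X in _ + X](scale0r ((0, V) : 'M[R]_(r, d) * 'M[R]_(r, d))).
  rewrite -v1 -[RHS]v2.
  apply: near_eq_derive.
  have : \forall t \near (0 : R), `|t| <= 1.
    by exists 1 => //= t; rewrite /ball_ /= sub0r normrN => /ltW.
  apply: filterS => t t1; rewrite addE hW //; first exact: stiefel_tangentZ.
  by rewrite normrZ; apply: ler_piMl.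
rewrite dh -(hW V) // -(hW 0) ?rho0 ?normr0 //; last exact: stiefel_tangent0.
apply; first by apply: inb; rewrite ?normr0 // ge_min lexx.
  by apply: inb; rewrite // ge_min lexx.
by move=> p; exact: le_mx_norm.
Qed.

(** Compactness makes the local bounds uniform for small [V]. For larger [V] the entries of
    [rho Y V] and [Y] are at most 1, which is dominated by a multiple of [|V|^2]. *)
Lemma retraction_bound : exists2 C : R, 0 <= C &
  forall Y V, stiefel Y -> stiefel_tangent Y V ->
    `|rho Y V - Y - V| <= C * `|V| ^+ 2 /\ `|rho Y V - Y| <= C * `|V|.
Proof.
(* One parameter serves both as the constant and as the inverse of the radius, so that the covering
   argument runs along [C] tending to infinity. Neighbourhoods also contain points off the Stiefel
   manifold, hence the condition [stiefel Y] inside [P]. *)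
pose P (C : R) (v : 'rV[R]_(r * d)) := let Y : 'M[R]_(r, d) := vec_mx v in
  forall V, stiefel Y -> stiefel_tangent Y V -> `|V| <= C^-1 ->
    `|rho Y V - Y - V| <= C * `|V| ^+ 2.
have /compact_near_coveringP/(_ R +oo%R P _) cov := @stiefel_compact R r d.
have {cov} : \forall C \near +oo%R, [set v | stiefel (vec_mx v : 'M[R]_(r, d))] `<=` P C.
  apply: cov => v /= vS; have [eps [C0 [eps0 bnd]]] := retraction_local_bound vS.
  exists (ball v eps, [set C | C > Num.max C0 (2 / eps)]); first split => /=.
  - exact: nbhsx_ballx.
  - by apply: nbhs_pinfty_gt; exact: num_real.
  move=> [u C] /= [vu]; rewrite gt_max => /andP[C0C eC] Y V uS tV VC.
  have C_gt0 : 0 < C by rewrite (lt_trans _ eC) // divr_gt0.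
  apply: (@le_trans _ _ (C0 * `|V| ^+ 2)); last by rewrite ler_wpM2r ?sqr_ge0 // ltW.
  apply: bnd => //.
    move: vu; rewrite /Y -!ball_normE /= -linearB /=.
    apply: le_lt_trans; apply: mx_norm_le => // i j.
    by rewrite mxE; exact: le_mx_norm.
  rewrite (le_lt_trans VC) // -[eps]invrK ltf_pV2 ?posrE ?invr_gt0 //.
  apply: lt_trans eC; rewrite -[ltLHS]mul1r ltr_pM2r ?invr_gt0 //; lra.
case=> M [_ HM]; pose C := `|M| + 1.
have C1 : 1 <= C by rewrite lerDr.
have Q : [set v | stiefel (vec_mx v : 'M[R]_(r, d))] `<=` P C.
  by apply: HM; rewrite (le_lt_trans (ler_norm M)) // ltrDl.
have C0 : 0 < C by apply: lt_le_trans C1.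
case: hrho => rhoS _ _ _.
have B1 Y V : stiefel Y -> stiefel_tangent Y V ->
    `|rho Y V - Y - V| <= (2 * C ^+ 2 + C) * `|V| ^+ 2.
  move=> YS tV; have [VC|VC] := leP `|V| C^-1.
    have := Q (mxvec Y); rewrite /P /= mxvecK => /(_ YS V YS tV VC) /le_trans; apply.
    by rewrite ler_wpM2r ?sqr_ge0 // lerDr mulr_ge0 // sqr_ge0.
  (* Since [C * |V| >= 1], the trivial bound [2 + |V|] is at most [2 C^2 |V|^2 + C |V|^2]. *)
  have CV : 1 <= C * `|V| by rewrite -(mulfV (lt0r_neq0 C0)) ler_wpM2l // ltW.
  apply: (@le_trans _ _ (2 + `|V|)).
    apply: le_trans (ler_normB _ _) _; rewrite lerD2r.
    apply: le_trans (ler_normB _ _) _; rewrite -[2]/(1 + 1).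
    by apply: lerD; apply: stiefel_norm_le1 => //; exact: rhoS.
  have V0 := normr_ge0 V.
  nra.
(* As [C >= 1], the extra [3 * C] pays for the term [|V|] when [|V| <= 1] and for the trivial bound
   2 when [|V| > 1]. *)
exists (2 * C ^+ 2 + C + 3 * C) => [|Y V YS tV].
  by rewrite !addr_ge0 // !mulr_ge0 // ?ltW.
have V0 := normr_ge0 V.
have CC : C <= C ^+ 2 by rewrite expr2 ler_peMl // ltW.
split.
  apply: le_trans (B1 _ _ YS tV) _; rewrite ler_wpM2r ?sqr_ge0 // lerDl.
  by rewrite mulr_ge0 // ltW.
have [V1|V1] := leP `|V| 1.
  rewrite -[rho Y V - Y](subrK V); apply: le_trans (ler_normD _ _) _.
  have := B1 _ _ YS tV => b.
  have VV : `|V| ^+ 2 <= `|V| by rewrite expr2 ler_piMl.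
  nra.
apply: (@le_trans _ _ 2); last by nra.
apply: le_trans (ler_normB _ _) _; rewrite -[2]/(1 + 1).
by apply: lerD; apply: stiefel_norm_le1 => //; exact: rhoS.
Qed.

End RetractionBound.

(** * Quadratic functions *)

(** Lagrange's identity: twice the difference of the two sides is the sum of the squares of
    [a i * b j - a j * b i]. *)
Lemma sum_CauchySchwarz (R : realType) (J : finType) (a b : J -> R) :
  (\sum_j a j * b j) ^+ 2 <= (\sum_j a j ^+ 2) * (\sum_j b j ^+ 2).
Proof.
have : 0 <= \sum_i \sum_j (a i * b j - a j * b i) ^+ 2.
  by apply: sumr_ge0 => i _; apply: sumr_ge0 => j _; exact: sqr_ge0.
have E i j : (a i * b j - a j * b i) ^+ 2 = a i ^+ 2 * b j ^+ 2
    + b i ^+ 2 * a j ^+ 2 + - 2 * (a i * b i) * (a j * b j) by ring.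
under eq_bigr => i _ do under eq_bigr => j _ do rewrite E.
under eq_bigr => i _ do rewrite !big_split /= -!mulr_sumr.
rewrite !big_split /= -!mulr_suml -mulr_sumr.
set A := \sum_j a j ^+ 2; set B := \sum_j b j ^+ 2; set C := \sum_j a j * b j.
by rewrite expr2; lra.
Qed.

Section Frobenius.
Variables (R : realType) (m n : nat).
Implicit Types A B C : 'M[R]_(m, n).

Lemma frobE A B : frob A B = \sum_(p : 'I_m * 'I_n) A p.1 p.2 * B p.1 p.2.
Proof.
rewrite /frob /mxtrace -(pair_bigA _ (fun i j => A i j * B i j)) exchange_big /=.
by apply: eq_bigr => j _; rewrite mxE; apply: eq_bigr => i _; rewrite mxE.
Qed.

Lemma frobC A B : frob A B = frob B A.
Proof. by rewrite !frobE; apply: eq_bigr => p _; rewrite mulrC. Qed.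

Lemma frobDr A B C : frob A (B + C) = frob A B + frob A C.
Proof. by rewrite /frob mulmxDr linearD. Qed.

Lemma frobZr t A B : frob A (t *: B) = t * frob A B.
Proof. by rewrite /frob -scalemxAr linearZ. Qed.

Lemma frobDl A B C : frob (A + B) C = frob A C + frob B C.
Proof. by rewrite frobC frobDr !(frobC C). Qed.

Lemma frobZl t A B : frob (t *: A) B = t * frob A B.
Proof. by rewrite frobC frobZr frobC. Qed.

Lemma frob_ge0 A : 0 <= frob A A.
Proof. by rewrite frobE; apply: sumr_ge0 => p _; rewrite -expr2 sqr_ge0. Qed.

Lemma frob_norm A : frob A A <= (m * n)%:R * `|A| ^+ 2.
Proof.
rewrite frobE (@le_trans _ _ (\sum_(p : 'I_m * 'I_n) `|A| ^+ 2)) //.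
  apply: ler_sum => p _; rewrite -expr2 -real_normK ?num_real //.
  by rewrite lerXn2r ?nnegrE // le_mx_norm.
by rewrite sumr_const card_prod !card_ord mulr_natl.
Qed.

Lemma norm_frob A : `|A| ^+ 2 <= frob A A.
Proof.
have -> : `|A| ^+ 2 = (Num.sqrt (`|A| ^+ 2)) ^+ 2 by rewrite sqr_sqrtr // sqr_ge0.
rewrite sqrtr_sqr ger0_norm // -[leRHS]sqr_sqrtr ?frob_ge0 //.
rewrite lerXn2r ?nnegrE ?sqrtr_ge0 //.
apply: mx_norm_le; first exact: sqrtr_ge0.
move=> i j; rewrite -sqrtr_sqr ler_wsqrtr // frobE (bigD1 (i, j)) //= expr2 lerDl.
by apply: sumr_ge0 => p _; rewrite -expr2 sqr_ge0.
Qed.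

Lemma frob_CauchySchwarz A B : frob A B ^+ 2 <= frob A A * frob B B.
Proof.
rewrite !frobE; apply: le_trans (sum_CauchySchwarz _ _) _.
by apply: ler_pM; rewrite ?sumr_ge0 // => *; rewrite ?sqr_ge0.
Qed.

End Frobenius.

(** Cauchy-Schwarz in each entry of the product. *)
Lemma frob_mulmx (R : realType) (m n p : nat) (A : 'M[R]_(m, n)) (B : 'M[R]_(n, p)) :
  frob (A *m B) (A *m B) <= frob A A * frob B B.
Proof.
rewrite !frobE.
have -> : (\sum_(q : 'I_m * 'I_n) A q.1 q.2 * A q.1 q.2) *
    (\sum_(q : 'I_n * 'I_p) B q.1 q.2 * B q.1 q.2) =
    \sum_(q : 'I_m * 'I_p) (\sum_k A q.1 k ^+ 2) * (\sum_k B k q.2 ^+ 2).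
  rewrite -(pair_bigA _ (fun i k => A i k * A i k)) /=.
  rewrite -(pair_bigA _ (fun i k => B i k * B i k)) /=.
  rewrite [X in _ * X]exchange_big /= mulr_suml.
  rewrite -(pair_bigA _ (fun i j => (\sum_k A i k ^+ 2) * \sum_k B k j ^+ 2)) /=.
  by apply: eq_bigr => i _; rewrite mulr_sumr.
apply: ler_sum => q _; rewrite mxE -expr2; exact: sum_CauchySchwarz.
Qed.

Lemma frob_hsubmx (R : realType) (m n1 n2 : nat) (A B : 'M[R]_(m, n1 + n2)) :
  frob A B = frob (lsubmx A) (lsubmx B) + frob (rsubmx A) (rsubmx B).
Proof.
by rewrite -{1}[A]hsubmxK -{1}[B]hsubmxK /frob tr_row_mx mul_col_row mxtrace_block.
Qed.

Section Dot.
Variables (R : realType) (r d : nat) (I : finType).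
Implicit Types X Y Z : {ffun I -> 'M[R]_(r, d + 1)}.

Lemma dotE X Z : dot X Z =
  \sum_(p : I * ('I_r * 'I_(d + 1))) X p.1 p.2.1 p.2.2 * Z p.1 p.2.1 p.2.2.
Proof.
rewrite -(pair_bigA _ (fun i q => X i q.1 q.2 * Z i q.1 q.2)) /=.
by apply: eq_bigr => i _; rewrite frobE.
Qed.

Lemma dotC X Z : dot X Z = dot Z X.
Proof. by apply: eq_bigr => i _; rewrite frobC. Qed.

Lemma dotDr X Y Z : dot X (Y + Z) = dot X Y + dot X Z.
Proof. by rewrite -big_split; apply: eq_bigr => i _; rewrite ffunE frobDr. Qed.

Lemma dotZr t X Z : dot X (t *: Z) = t * dot X Z.
Proof. by rewrite mulr_sumr; apply: eq_bigr => i _; rewrite ffunE frobZr. Qed.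

Lemma dotDl X Y Z : dot (X + Y) Z = dot X Z + dot Y Z.
Proof. by rewrite dotC dotDr !(dotC Z). Qed.

Lemma dotZl t X Z : dot (t *: X) Z = t * dot X Z.
Proof. by rewrite dotC dotZr dotC. Qed.

Lemma dotNr X Z : dot X (- Z) = - dot X Z.
Proof. by rewrite -scaleN1r dotZr mulN1r. Qed.

Lemma dot0r X : dot X 0 = 0.
Proof. by rewrite -(scale0r X) dotZr mul0r. Qed.

Lemma dot_ge0 X : 0 <= dot X X.
Proof. by apply: sumr_ge0 => i _; exact: frob_ge0. Qed.

Lemma nrm_ge0 X : 0 <= nrm X.
Proof. exact: sqrtr_ge0. Qed.

Lemma sqr_nrm X : nrm X ^+ 2 = dot X X.
Proof. by rewrite sqr_sqrtr // dot_ge0. Qed.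

Lemma nrmZ t X : nrm (t *: X) = `|t| * nrm X.
Proof.
rewrite /nrm dotZr dotZl mulrA -expr2 sqrtrM ?sqr_ge0 //.
by rewrite sqrtr_sqr.
Qed.

Lemma nrmN X : nrm (- X) = nrm X.
Proof. by rewrite -scaleN1r nrmZ normrN1 mul1r. Qed.

Lemma nrm_eq0 X : nrm X = 0 -> X = 0.
Proof.
move=> X0; have := sqr_nrm X; rewrite X0 expr0n /= dotE => /esym/eqP.
rewrite psumr_eq0 => [/allP z|p _]; last by rewrite -expr2 sqr_ge0.
apply/ffunP => i; apply/matrixP => a b; rewrite ffunE mxE.
have := z (i, (a, b)) (mem_index_enum _).
by rewrite /= -expr2 sqrf_eq0 => /eqP.
Qed.

Lemma nrm_gt0 X : X <> 0 -> 0 < nrm X.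
Proof. by move=> X0; rewrite lt_neqAle nrm_ge0 andbT eq_sym; apply/eqP => /nrm_eq0. Qed.

Lemma dot_CauchySchwarz X Z : `|dot X Z| <= nrm X * nrm Z.
Proof.
rewrite -(@ler_sqr _ `|_|) ?nnegrE ?mulr_ge0 ?nrm_ge0 //.
rewrite exprMn !sqr_nrm real_normK ?num_real // !dotE.
apply: le_trans (sum_CauchySchwarz _ _) _.
by apply: ler_pM; rewrite ?sumr_ge0 // => *; rewrite ?sqr_ge0.
Qed.

Lemma nrm_le X (C : R) : 0 <= C -> dot X X <= C ^+ 2 -> nrm X <= C.
Proof.
by move=> C0 XC; rewrite -ler_sqr ?nnegrE ?nrm_ge0 // sqr_nrm.
Qed.

End Dot.

(** The projection formula is quadratic in the base point and linear in the projected matrix, so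
    along a line it is a cubic polynomial in [t]. The derivatives in [egrad] and [rhess] of a
    quadratic function are thus read off as coefficients. *)
Lemma derive1_cubic (R : realType) (V : normedModType R) (M0 M1 M2 M3 : V) :
  derive1 (fun t : R => M0 + t *: M1 + t ^+ 2 *: M2 + t ^+ 3 *: M3) 0 = M1.
Proof.
apply: cvg_lim => //.
have c : M1 + h *: M2 + (h ^+ 2) *: M3 @[h --> (0 : R)^'] --> M1.
  have idc : (id : R -> R) h @[h --> (0 : R)^'] --> (0 : R).
    by apply: cvg_within_filter; exact: cvg_id.
  rewrite -[X in _ --> X]addr0 -[X in _ --> X]addr0; apply: cvgD.
    apply: cvgD; first exact: cvg_cst.
    by rewrite -[X in _ --> X](scale0r M2); apply: cvgZr_tmp.
  rewrite -[X in _ --> X](scale0r M3); apply: cvgZr_tmp.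
  rewrite -[X in _ --> X](mulr0 0); exact: cvgM.
apply: cvg_trans c; apply: near_eq_cvg; near=> h.
have h0 : h != 0 by near: h; exact: nbhs_dnbhs_neq.
rewrite /= addr0 !expr0n /= !scale0r !addr0.
rewrite [_ - M0]addrC !addrA addNr add0r !scalerDr !scalerA.
have -> : h^-1 * h ^+ 2 = h by rewrite expr2 mulKf.
have -> : h^-1 * h ^+ 3 = h ^+ 2 by rewrite exprS mulKf.
by rewrite mulVf // scale1r.
Unshelve. all: by end_near.
Qed.

Section StiefelProjection.
Variables (R : realType) (r d : nat).
Implicit Types Y V Z W : 'M[R]_(r, d).

(** The symmetric part of [Y^T *m Z]; the tangent projection is [Z - Y *m symmx Y Z]. *)
Definition symmx Y Z : 'M[R]_d := 2^-1 *: (Y^T *m Z + Z^T *m Y).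

(** The derivative of [stiefel_tproj] at [(Y, Z)] in the direction [(V, W)]. *)
Definition dtproj Y V Z W : 'M[R]_(r, d) :=
  W - V *m symmx Y Z - Y *m (symmx V Z + symmx Y W).

Lemma symmxDl Y V Z : symmx (Y + V) Z = symmx Y Z + symmx V Z.
Proof.
by rewrite /symmx -scalerDr mulmxDr [(Y + V)^T]linearD mulmxDl addrACA.
Qed.

Lemma symmxC Y Z : symmx Y Z = symmx Z Y.
Proof. by rewrite /symmx addrC. Qed.

Lemma symmxZl t Y Z : symmx (t *: Y) Z = t *: symmx Y Z.
Proof.
rewrite /symmx [(t *: Y)^T]linearZ -scalemxAl -scalemxAr -scalerDr scalerA.
by rewrite mulrC -scalerA.
Qed.

Lemma tr_symmx Y Z : (symmx Y Z)^T = symmx Y Z.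
Proof. by rewrite /symmx linearZ linearD /= !trmx_mul !trmxK addrC. Qed.

Lemma stiefel_tproj_line Y V Z W (t : R) :
  stiefel_tproj (Y + t *: V) (Z + t *: W) =
  stiefel_tproj Y Z + t *: dtproj Y V Z W
  + t ^+ 2 *: (- (V *m (symmx V Z + symmx Y W)) - Y *m symmx V W)
  + t ^+ 3 *: - (V *m symmx V W).
Proof.
rewrite /stiefel_tproj -!/(symmx _ _) /dtproj.
rewrite !symmxDl !symmxZl !(symmxC _ (_ + _)) !symmxDl !symmxZl.
rewrite !(symmxC _ Y) !(symmxC _ V).
move: (symmx Y Z) (symmx Y W) (symmx V Z) (symmx V W) => s1 s2 s3 s4.
rewrite !(scalerDr, mulmxDl, mulmxDr) -!scalemxAl -!scalemxAr.
move: (Y *m s1) (Y *m s2) (Y *m s3) (Y *m s4)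
  (V *m s1) (V *m s2) (V *m s3) (V *m s4) => *.
by apply/matrixP => i j; rewrite !mxE; ring.
Qed.

(* A symmetric matrix is orthogonal to the skew matrix [Y^T V]. *)
Lemma frob_tangent_sym Y V (S : 'M[R]_d) : stiefel_tangent Y V -> S^T = S ->
  frob V (Y *m S) = 0.
Proof.
move=> tV ST; rewrite /frob mulmxA.
have VY : V^T *m Y = - (Y^T *m V) by apply/eqP; rewrite -addr_eq0 addrC tV.
have : \tr (V^T *m Y *m S) = - \tr (V^T *m Y *m S).
  rewrite -{1}mxtrace_tr trmx_mul ST mxtrace_mulC trmx_mul trmxK.
  by rewrite -[Y^T *m V]opprK -VY mulNmx raddfN.
by lra.
Qed.

Lemma frob_tangent_proj Y V Z : stiefel_tangent Y V ->
  frob V (stiefel_tproj Y Z) = frob V Z.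
Proof.
move=> tV; rewrite /stiefel_tproj -/(symmx Y Z) -scaleN1r frobDr frobZr.
by rewrite frob_tangent_sym ?tr_symmx // mulr0 addr0.
Qed.

(** The part of the form [Y] times a symmetric matrix is normal and drops out. What remains besides
    [W] is the curvature term of the Riemannian Hessian. *)
Lemma frob_tangent_dtproj Y V Z W : stiefel_tangent Y V ->
  frob V (dtproj Y V Z W) = frob V W - frob V (V *m symmx Y Z).
Proof.
move=> tV; rewrite /dtproj -scaleN1r -[- (Y *m _)]scaleN1r !frobDr !frobZr.
rewrite (@frob_tangent_sym Y) // ?mulr0 ?addr0 ?mulN1r //.
by rewrite [LHS]linearD /= [X in X + _]tr_symmx [X in _ + X]tr_symmx.
Qed.

(** Taking the symmetric part does not increase the Frobenius norm, as [A - A^T] has nonnegative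
    square, and [Y] has squared norm [d]. *)
Lemma frob_symmx_le Y Z : stiefel Y ->
  frob (symmx Y Z) (symmx Y Z) <= d%:R * frob Z Z.
Proof.
move=> YS.
have trE (A : 'M[R]_d) : frob A^T A^T = frob A A.
  by rewrite /frob trmxK mxtrace_mulC.
have YT : frob Y^T Y^T = d%:R.
  rewrite /frob trmxK mxtrace_mulC YS mxtrace1 //.
have le1 := frob_mulmx Y^T Z; rewrite YT in le1.
apply: le_trans le1; rewrite /symmx.
set A := Y^T *m Z.
have -> : Z^T *m Y = A^T by rewrite trmx_mul trmxK.
have : 0 <= frob (A - A^T) (A - A^T) by exact: frob_ge0.
rewrite -scaleN1r !(frobZr, frobZl, frobDr, frobDl) trE [frob A^T A]frobC.
lra.
Qed.

End StiefelProjection.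

(** * Riemannian gradient and Hessian of a quadratic function *)

Section Quadratic.
Variables (R : realType) (r d : nat) (I : finType).
Implicit Types x v eta Z : {ffun I -> 'M[R]_(r, d + 1)}.
Variables (g : {ffun I -> 'M[R]_(r, d + 1)} -> R)
  (G A : {ffun I -> 'M[R]_(r, d + 1)} -> {ffun I -> 'M[R]_(r, d + 1)}).
Hypothesis gE : forall x v, g (x + v) = g x + dot (G x) v + 2^-1 * dot (A v) v.
Hypothesis GE : forall x v t, G (x + t *: v) = G x + t *: A v.
Hypothesis AZ : forall t v, A (t *: v) = t *: A v.

Lemma dot_tproj x eta Z : tangent x eta -> dot eta (tproj x Z) = dot eta Z.
Proof.
move=> t; apply: eq_bigr => i _; rewrite ffunE.
by rewrite !frob_hsubmx row_mxKl row_mxKr frob_tangent_proj.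
Qed.

Lemma tangent_tproj x Z : manifold x -> tangent x (tproj x Z).
Proof.
by move=> xM i; rewrite ffunE row_mxKl; have [] := stiefel_tprojP (lsubmx (Z i)) (xM i).
Qed.

Lemma quadratic_egrad x : egrad g x = G x.
Proof.
apply/ffunP => i; rewrite ffunE; apply/matrixP => a c; rewrite mxE.
set e : {ffun I -> 'M[R]_(r, d + 1)} := [ffun j => _].
have -> : (fun t : R => g (x + t *: e)) = fun t : R => g x + t *: dot (G x) e +
    t ^+ 2 *: (2^-1 * dot (A e) e) + t ^+ 3 *: 0.
  apply/funext => t; rewrite gE AZ dotZr dotZl dotZr scaler0 addr0.
  by rewrite /GRing.scale /=; ring.
rewrite derive1_cubic dotE (bigD1 (i, (a, c))) //= ffunE eqxx mxE !eqxx mulr1.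
rewrite big1 ?addr0 // => -[j [a' c']]; rewrite !xpair_eqE /= ffunE.
case: (j == i) => /=; last by rewrite mxE mulr0.
by rewrite mxE => /negPf ->; rewrite mulr0.
Qed.

Lemma quadratic_dot_rgrad x eta : tangent x eta ->
  dot eta (rgrad g x) = dot eta (G x).
Proof. by move=> t; rewrite /rgrad quadratic_egrad dot_tproj. Qed.

(** The outer projection is invisible to a tangent [eta], so the form is the Euclidean Hessian minus
    the curvature terms of the Stiefel factors. *)
Lemma quadratic_dot_rhess x eta : tangent x eta ->
  dot eta (rhess g x eta) = dot eta (A eta)
    - \sum_i frob (lsubmx (eta i))
        (lsubmx (eta i) *m symmx (lsubmx (x i)) (lsubmx (G x i))).
Proof.
move=> t; rewrite dot_tproj //.
have row_cubic (s : R) (a0 a1 a2 a3 : 'M[R]_(r, d)) (b0 b1 : 'M[R]_(r, 1)) :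
    row_mx (a0 + s *: a1 + s ^+ 2 *: a2 + s ^+ 3 *: a3) (b0 + s *: b1) =
    row_mx a0 b0 + s *: row_mx a1 b1 + s ^+ 2 *: row_mx a2 0 + s ^+ 3 *: row_mx a3 0.
  by rewrite !scale_row_mx !add_row_mx !scaler0 !addr0.
have lE (s : R) (X W : 'M[R]_(r, d + 1)) :
  lsubmx (X + s *: W) = lsubmx X + s *: lsubmx W by rewrite linearD linearZ.
have rE (s : R) (X W : 'M[R]_(r, d + 1)) :
  rsubmx (X + s *: W) = rsubmx X + s *: rsubmx W by rewrite linearD linearZ.
rewrite -sumrB; apply: eq_bigr => i _; rewrite ffunE.
have -> : (fun s : R => rgrad g (x + s *: eta) i) = (fun s : R =>
    row_mx (stiefel_tproj (lsubmx (x i)) (lsubmx (G x i))) (rsubmx (G x i))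
  + s *: row_mx (dtproj (lsubmx (x i)) (lsubmx (eta i)) (lsubmx (G x i)) (lsubmx (A eta i)))
       (rsubmx (A eta i))
  + s ^+ 2 *: row_mx
      (- (lsubmx (eta i) *m (symmx (lsubmx (eta i)) (lsubmx (G x i))
                             + symmx (lsubmx (x i)) (lsubmx (A eta i))))
       - lsubmx (x i) *m symmx (lsubmx (eta i)) (lsubmx (A eta i))) 0
  + s ^+ 3 *: row_mx (- (lsubmx (eta i) *m symmx (lsubmx (eta i)) (lsubmx (A eta i)))) 0).
  apply/funext => s; rewrite /rgrad ffunE quadratic_egrad GE !ffunE.
  rewrite !lE rE stiefel_tproj_line.
  exact: row_cubic.
rewrite derive1_cubic !frob_hsubmx row_mxKl row_mxKr frob_tangent_dtproj //.
by rewrite addrAC.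
Qed.

(** Homogeneity is read off the explicit formula. It extends a bound on the Hessian form from unit
    vectors to all tangent vectors. *)
Lemma quadratic_dot_rhessZ x eta t : tangent x eta ->
  dot (t *: eta) (rhess g x (t *: eta)) = t ^+ 2 * dot eta (rhess g x eta).
Proof.
move=> te; have tte : tangent x (t *: eta).
  by move=> i; rewrite ffunE linearZ; exact: stiefel_tangentZ.
rewrite !quadratic_dot_rhess // AZ dotZl dotZr mulrA -expr2 mulrBr.
congr (_ - _); rewrite mulr_sumr; apply: eq_bigr => i _.
by rewrite ffunE linearZ /= frobZl -scalemxAl frobZr mulrA -expr2.
Qed.

End Quadratic.

(** * Restriction to a block and extension from a block *)

Section Blocks.
Variables (R : realType) (r d n N : nat) (blk : 'I_n -> 'I_N) (b : 'I_N).
Implicit Types X W : {ffun 'I_n -> 'M[R]_(r, d + 1)}.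
Implicit Types Z V : {ffun block blk b -> 'M[R]_(r, d + 1)}.

Lemma merge_in X Z (j : block blk b) : Defs.merge X Z (val j) = Z j.
Proof. by rewrite ffunE valK. Qed.

Lemma merge_out X Z i : blk i != b -> Defs.merge X Z i = X i.
Proof. by move=> ib; rewrite ffunE insubF //; exact/negbTE. Qed.

Lemma restr_merge X Z : restr blk b (Defs.merge X Z) = Z.
Proof. by apply/ffunP => j; rewrite ffunE merge_in. Qed.

Lemma merge_restr X : Defs.merge X (restr blk b X) = X.
Proof.
by apply/ffunP => i; rewrite ffunE; case: insubP => // j _ <-; rewrite ffunE.
Qed.

Lemma mergeD X Z V : Defs.merge X (Z + V) = Defs.merge X Z + Defs.merge 0 V.
Proof.
apply/ffunP => i; rewrite !ffunE; case: insub => [j|]; first by rewrite ffunE.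
by rewrite addr0.
Qed.

Lemma merge0Z t V : Defs.merge 0 (t *: V) = t *: Defs.merge 0 V :> {ffun 'I_n -> _}.
Proof.
apply/ffunP => i; rewrite !ffunE; case: insub => [j|]; first by rewrite ffunE.
by rewrite scaler0.
Qed.

Lemma sum_block (F : 'I_n -> R) :
  \sum_(i | blk i == b) F i = \sum_(j : block blk b) F (val j).
Proof.
rewrite (reindex_omap (val : block blk b -> 'I_n) insub) => [|i ib]; last by rewrite insubT.
by apply: eq_bigl => j; rewrite valK eqxx andbT; exact: (valP j).
Qed.

(** Extension by zero is the adjoint of restriction; this turns derivatives of the full cost into
    those of the reduced cost. *)
Lemma dot_merge0 W V : dot W (Defs.merge 0 V) = dot (restr blk b W) V.
Proof.
rewrite /dot (bigID (fun i => blk i == b)) /= addrC big1 ?add0r => [|i ib].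
  rewrite sum_block.
  by apply: eq_bigr => j _; rewrite merge_in [in RHS]ffunE.
by rewrite merge_out // ffunE -(scale0r (W i)) frobZr mul0r.
Qed.

Lemma nrm_merge0 V : nrm (Defs.merge 0 V : {ffun 'I_n -> _}) = nrm V.
Proof. by rewrite /nrm dot_merge0 restr_merge. Qed.

Lemma restrZ t W : restr blk b (t *: W) = t *: restr blk b W.
Proof. by apply/ffunP => j; rewrite !ffunE. Qed.

Lemma restrD X W : restr blk b (X + W) = restr blk b X + restr blk b W.
Proof. by apply/ffunP => j; rewrite !ffunE. Qed.

Lemma restr_tproj X W : restr blk b (tproj X W) = tproj (restr blk b X) (restr blk b W).
Proof. by apply/ffunP => j; rewrite !ffunE. Qed.

Lemma manifold_restr X : manifold X -> manifold (restr blk b X).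
Proof. by move=> XM j; rewrite ffunE; exact: XM. Qed.

Lemma manifold_merge X Z : manifold X -> manifold Z -> manifold (Defs.merge X Z).
Proof. by move=> XM ZM i; rewrite ffunE; case: insub => [j|]; [exact: ZM|exact: XM]. Qed.

End Blocks.

Lemma sum_sqr_nrm_restr (R : realType) (r d n N : nat) (blk : 'I_n -> 'I_N)
    (W : {ffun 'I_n -> 'M[R]_(r, d + 1)}) :
  \sum_b nrm (restr blk b W) ^+ 2 = nrm W ^+ 2.
Proof.
rewrite sqr_nrm [in RHS]/dot (partition_big blk xpredT) //=; apply: eq_bigr => b _.
rewrite sqr_nrm sum_block.
by apply: eq_bigr => j _; rewrite ffunE.
Qed.

Lemma nrm_restr_le (R : realType) (r d n N : nat) (blk : 'I_n -> 'I_N) b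
    (W : {ffun 'I_n -> 'M[R]_(r, d + 1)}) :
  nrm (restr blk b W) <= nrm W.
Proof.
rewrite -ler_sqr ?nnegrE ?nrm_ge0 // -(sum_sqr_nrm_restr blk W) (bigD1 b) //= lerDl.
by apply: sumr_ge0 => i _; exact: sqr_ge0.
Qed.

(** * The cost and the reduced costs as quadratic forms *)

Section Cost.
Variables (R : realType) (r d n : nat).
Variable Q : 'M[R]_(\sum_(i < n) (d + 1)).
Implicit Types X Z : {ffun 'I_n -> 'M[R]_(r, d + 1)}.

(** The product of [concat X] with [Q], cut back into poses. For symmetric [Q] it is half the
    Euclidean gradient of the cost. *)
Definition lapl X : {ffun 'I_n -> 'M[R]_(r, d + 1)} :=
  [ffun i => submxrow (concat X *m Q) i].

Lemma frob_concat X Z : frob (concat X) (concat Z) = dot X Z.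
Proof.
rewrite /frob mxtrace_mulC tr_mxrow mul_mxrow_mxcol raddf_sum.
by apply: eq_bigr => i _; rewrite /= /frob mxtrace_mulC.
Qed.

Lemma concat_lapl X : concat (lapl X) = concat X *m Q.
Proof.
rewrite -[RHS]submxrowK /concat; apply/eq_mxrowP => i.
by rewrite ffunE.
Qed.

Lemma concatD X Z : concat (X + Z) = concat X + concat Z.
Proof. by apply/matrixP => i j; rewrite !mxE ffunE mxE. Qed.

Lemma concatZ t X : concat (t *: X) = t *: concat X.
Proof. by apply/matrixP => i j; rewrite !mxE ffunE mxE. Qed.

Lemma laplD X Z : lapl (X + Z) = lapl X + lapl Z.
Proof.
apply/ffunP => i; rewrite !ffunE concatD mulmxDl.
by apply/matrixP => a c; rewrite !mxE.
Qed.

Lemma laplZ t X : lapl (t *: X) = t *: lapl X.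
Proof.
apply/ffunP => i; rewrite !ffunE concatZ -scalemxAl.
by apply/matrixP => a c; rewrite !mxE.
Qed.

Lemma cost_lapl X : cost Q X = dot (lapl X) X.
Proof. by rewrite -frob_concat concat_lapl /cost /frob trmx_mul mulmxA. Qed.

Lemma nrm_lapl X : nrm (lapl X) <= Num.sqrt (frob Q Q) * nrm X.
Proof.
apply: nrm_le; first by rewrite mulr_ge0 ?sqrtr_ge0 ?nrm_ge0.
rewrite -frob_concat concat_lapl exprMn sqr_sqrtr ?frob_ge0 // sqr_nrm -frob_concat mulrC.
exact: frob_mulmx.
Qed.

Hypothesis QT : Q^T = Q.

Lemma laplC X Z : dot (lapl X) Z = dot (lapl Z) X.
Proof.
rewrite -!frob_concat !concat_lapl frobC /frob !trmx_mul QT.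
by rewrite mulmxA mxtrace_mulC mulmxA.
Qed.

Lemma costD X Z : cost Q (X + Z) = cost Q X + 2 * dot (lapl X) Z + cost Q Z.
Proof. by rewrite !cost_lapl laplD dotDl !dotDr (laplC Z X); ring. Qed.

Hypothesis psd : forall X, 0 <= cost Q X.

(* Hence the gradient is bounded on sublevel sets, although these are
   unbounded in the translations. *)
Lemma dot_lapl_le X Z : `|2 * dot (lapl X) Z| <= cost Q X + cost Q Z.
Proof.
have h1 := psd (X + Z); rewrite costD in h1.
have h2 := psd (X + -1 *: Z).
rewrite costD dotZr [cost Q (-1 *: Z)]cost_lapl laplZ dotZr dotZl -cost_lapl in h2.
by rewrite ler_norml; apply/andP; split; lra.
Qed.

(** In [dot_lapl_le] take for [Z] the unit vector along [lapl X], whose cost is at most the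
    Frobenius norm of [Q]. *)
Lemma nrm_lapl_sublevel X : 2 * nrm (lapl X) <= cost Q X + Num.sqrt (frob Q Q).
Proof.
set F := Num.sqrt _; have F0 : 0 <= F := sqrtr_ge0 _.
have [L0|L0] := eqVneq (nrm (lapl X)) 0; first by rewrite L0 mulr0 addr_ge0.
have Lp : 0 < nrm (lapl X) by rewrite lt_neqAle eq_sym L0 nrm_ge0.
pose E := (nrm (lapl X))^-1 *: lapl X.
have E1 : nrm E = 1.
  by rewrite nrmZ ger0_norm ?invr_ge0 ?nrm_ge0 // mulVf.
have := dot_lapl_le X E; rewrite /E dotZr -sqr_nrm expr2 mulKf // -/E.
rewrite ger0_norm ?mulr_ge0 ?nrm_ge0 // => /le_trans; apply; rewrite lerD2l.
rewrite cost_lapl; apply: le_trans (ler_norm _) _.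
apply: le_trans (dot_CauchySchwarz _ _) _; rewrite E1 mulr1.
by apply: le_trans (nrm_lapl _) _; rewrite E1 mulr1.
Qed.

Section Reduced.
Variables (N : nat) (blk : 'I_n -> 'I_N) (b : 'I_N) (X : {ffun 'I_n -> 'M[R]_(r, d + 1)}).
Notation cfg := ({ffun block blk b -> 'M[R]_(r, d + 1)}).
Notation fb := (reduced blk (cost Q) b X).

Definition redG (Z : cfg) : cfg := restr blk b (2 *: lapl (Defs.merge X Z)).
Definition redA (V : cfg) : cfg := restr blk b (2 *: lapl (Defs.merge 0 V)).

Lemma reduced_quadratic (Z V : cfg) :
  fb (Z + V) = fb Z + dot (redG Z) V + 2^-1 * dot (redA V) V.
Proof.
rewrite /reduced mergeD costD [cost Q (Defs.merge 0 V)]cost_lapl /redG /redA.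
by rewrite !restrZ !dotZl -!dot_merge0 mulKf ?pnatr_eq0.
Qed.

Lemma redG_line (Z V : cfg) t : redG (Z + t *: V) = redG Z + t *: redA V.
Proof.
rewrite /redG /redA mergeD merge0Z laplD laplZ !restrZ restrD restrZ.
by rewrite scalerDr !scalerA [2 * t]mulrC.
Qed.

Lemma redAZ t (V : cfg) : redA (t *: V) = t *: redA V.
Proof. by rewrite /redA merge0Z laplZ !restrZ !scalerA mulrC. Qed.

Lemma nrm_redA (V : cfg) : nrm (redA V) <= 2 * Num.sqrt (frob Q Q) * nrm V.
Proof.
apply: le_trans (nrm_restr_le _ _ _) _; rewrite nrmZ ger0_norm // -mulrA ler_pM2l //.
by rewrite -(nrm_merge0 V); exact: nrm_lapl.
Qed.

Lemma reduced_restr : fb (restr blk b X) = cost Q X.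
Proof. by rewrite /reduced merge_restr. Qed.

Lemma nrm_redG : nrm (redG (restr blk b X)) <= cost Q X + Num.sqrt (frob Q Q).
Proof.
apply: le_trans (nrm_restr_le _ _ _) _; rewrite nrmZ ger0_norm // merge_restr.
exact: nrm_lapl_sublevel.
Qed.

Lemma cost_egrad (W : {ffun 'I_n -> 'M[R]_(r, d + 1)}) :
  egrad (cost Q) W = 2 *: lapl W.
Proof.
apply: (@quadratic_egrad _ _ _ _ _ (fun W => 2 *: lapl W) (fun W => 2 *: lapl W)).
- move=> Y V; rewrite costD !dotZl mulKf ?pnatr_eq0 // -cost_lapl //.
- by move=> t V; rewrite laplZ scalerA mulrC -scalerA.
Qed.

(** Restriction commutes with the tangent projection, which acts pose by pose. So BlockUpdate sees
    exactly the block component of the full gradient. *)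
Lemma reduced_rgrad : rgrad fb (restr blk b X) = grad_block blk (cost Q) b X.
Proof.
rewrite /grad_block /rgrad (quadratic_egrad reduced_quadratic redAZ).
by rewrite cost_egrad restr_tproj /redG merge_restr.
Qed.

End Reduced.
End Cost.

(** * Uniform constants on the sublevel set *)

(** Allows [m.+1] in place of the square root of [m] in the constants below. *)
Lemma leq_sqrS (m : nat) : (m <= m.+1 ^ 2)%N.
Proof. by rewrite expnS expn1 (leq_trans (leqnSn m)) // leq_pmulr. Qed.

Lemma row_mx_sub (R : realType) (m n1 n2 : nat) (A : 'M[R]_(m, n1))
    (B : 'M[R]_(m, n2)) (X : 'M[R]_(m, n1 + n2)) :
  row_mx A B - X = row_mx (A - lsubmx X) (B - rsubmx X).
Proof. by rewrite -{1}[X]hsubmxK opp_row_mx add_row_mx. Qed.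

Section RetrBound.
Variables (R : realType) (r d : nat) (I : finType).
Variables (rho : I -> 'M[R]_(r, d) -> 'M[R]_(r, d) -> 'M[R]_(r, d)) (C : R).
Hypothesis C0 : 0 <= C.
Hypothesis rhoC : forall i Y V, stiefel Y -> stiefel_tangent Y V ->
  `|rho i Y V - Y - V| <= C * `|V| ^+ 2 /\ `|rho i Y V - Y| <= C * `|V|.
Variables x eta : {ffun I -> 'M[R]_(r, d + 1)}.
Hypotheses (xM : manifold x) (tx : tangent x eta).

Let K : R := (r * d).+1%:R * C.

Let K0 : 0 <= K. Proof. by rewrite mulr_ge0. Qed.

Let frobK (D : 'M[R]_(r, d)) (B : R) : `|D| <= C * B -> frob D D <= (K * B) ^+ 2.
Proof.
move=> DB; apply: le_trans (frob_norm _) _.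
have : `|D| ^+ 2 <= (C * B) ^+ 2.
  by rewrite lerXn2r ?nnegrE //; exact: le_trans DB.
move=> DB2; apply: le_trans (ler_wpM2l _ DB2) _; first exact: ler0n.
rewrite /K -mulrA [leRHS]exprMn ler_wpM2r ?sqr_ge0 //.
rewrite -natrX ler_nat; exact: leq_sqrS.
Qed.

(** Translations contribute no error. In the fourth power obtained for pose [i], one factor
    [|eta i|^2] is kept and the other enlarged to [|eta|^2]; the sum over poses then costs no
    factor. *)
Lemma nrm_retr_sub2 : nrm (retr rho x eta - x - eta) <= K * nrm eta ^+ 2.
Proof.
apply: nrm_le; first by rewrite mulr_ge0 // sqr_ge0.
apply: (@le_trans _ _ (\sum_i (K * nrm eta) ^+ 2 * frob (eta i) (eta i))); last first.
  rewrite -mulr_sumr -/(dot eta eta) -sqr_nrm.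
  by rewrite (_ : (K * nrm eta ^+ 2) ^+ 2 = (K * nrm eta) ^+ 2 * nrm eta ^+ 2) //; ring.
apply: ler_sum => i _; rewrite !ffunE !row_mx_sub frob_hsubmx row_mxKl row_mxKr.
rewrite [rsubmx (x i) + _]addrC addrK subrr.
have [b _] := rhoC i (xM i) (tx i).
set V := lsubmx (eta i) in b *.
rewrite [X in _ + X]/frob mulmx0 mxtrace0 addr0.
have Ve : frob V V <= frob (eta i) (eta i).
  by rewrite (frob_hsubmx (eta i)) lerDl frob_ge0.
have en : frob (eta i) (eta i) <= nrm eta ^+ 2.
  rewrite sqr_nrm /dot (bigD1 i) //= lerDl.
  by apply: sumr_ge0 => j _; exact: frob_ge0.
apply: le_trans (frobK b) _.
have VV : `|V| ^+ 2 <= frob V V := norm_frob V.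
rewrite (_ : (K * `|V| ^+ 2) ^+ 2 = K ^+ 2 * (`|V| ^+ 2 * `|V| ^+ 2)); last by ring.
rewrite (_ : (K * nrm eta) ^+ 2 * _ =
  K ^+ 2 * (nrm eta ^+ 2 * frob (eta i) (eta i))); last by ring.
rewrite ler_wpM2l ?sqr_ge0 //.
by apply: ler_pM; rewrite ?sqr_ge0 //; lra.
Qed.

Lemma nrm_retr_sub : nrm (retr rho x eta - x) <= (K + 1) * nrm eta.
Proof.
apply: nrm_le; first by rewrite mulr_ge0 ?nrm_ge0 // addr_ge0.
apply: (@le_trans _ _ (\sum_i (K + 1) ^+ 2 * frob (eta i) (eta i))); last first.
  by rewrite -mulr_sumr -/(dot eta eta) -sqr_nrm exprMn.
apply: ler_sum => i _; rewrite !ffunE row_mx_sub frob_hsubmx row_mxKl row_mxKr.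
rewrite [rsubmx (x i) + _]addrC addrK.
have [_ b] := rhoC i (xM i) (tx i).
rewrite (frob_hsubmx (eta i)) mulrDr; set V := lsubmx (eta i) in b *.
have VV : `|V| ^+ 2 <= frob V V := norm_frob V.
apply: lerD.
  apply: le_trans (frobK b) _; rewrite exprMn.
  apply: ler_pM; rewrite ?sqr_ge0 //.
  by rewrite lerXn2r ?nnegrE ?lerDl // addr_ge0.
rewrite -[leLHS]mul1r ler_wpM2r ?frob_ge0 // -[leLHS](expr1n _ 2).
by rewrite lerXn2r ?nnegrE ?lerDr // addr_ge0.
Qed.

End RetrBound.

Lemma uniform_retraction_bound (R : realType) (r d n : nat)
    (rho : 'I_n -> 'M[R]_(r, d) -> 'M[R]_(r, d) -> 'M[R]_(r, d)) :
  (forall i, smooth_retraction (rho i)) ->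
  exists2 C : R, 0 <= C & forall i Y V, stiefel Y -> stiefel_tangent Y V ->
    `|rho i Y V - Y - V| <= C * `|V| ^+ 2 /\ `|rho i Y V - Y| <= C * `|V|.
Proof.
move=> hrho.
have /choice[C HC] : forall i, exists C : R, 0 <= C /\
    forall Y V, stiefel Y -> stiefel_tangent Y V ->
    `|rho i Y V - Y - V| <= C * `|V| ^+ 2 /\ `|rho i Y V - Y| <= C * `|V|.
  by move=> i; have [C C0 HC] := retraction_bound (hrho i); exists C.
exists (\sum_i C i) => [|i Y V YS tV]; first by apply: sumr_ge0 => i _; case: (HC i).
have le : C i <= \sum_i C i.
  by rewrite (bigD1 i) //= lerDl; apply: sumr_ge0 => j _; case: (HC j).
have [_ /(_ Y V YS tV)[b1 b2]] := HC i.
split; first by apply: le_trans b1 _; rewrite ler_wpM2r // sqr_ge0.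
by apply: le_trans b2 _; rewrite ler_wpM2r.
Qed.

(** Let [D] be the displacement of the retraction, [G] the Euclidean gradient and [A] the Euclidean
    Hessian of the reduced cost. The first-order error is [dot G (D - eta)] plus half of
    [dot (A D) D], both of order [|eta|^2] by the retraction bounds; [B] bounds [G] on the sublevel
    set and [2 * F] bounds [A]. *)
Lemma admissible_exists (R : realType) (r d n N : nat) (blk : 'I_n -> 'I_N)
    (rho : 'I_n -> 'M[R]_(r, d) -> 'M[R]_(r, d) -> 'M[R]_(r, d))
    (Q : 'M[R]_(\sum_(i < n) (d + 1))) (X0 : {ffun 'I_n -> 'M[R]_(r, d + 1)}) :
  Q^T = Q -> (forall X : {ffun 'I_n -> 'M[R]_(r, d + 1)}, 0 <= cost Q X) ->
  (forall i, smooth_retraction (rho i)) ->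
  exists (c : 'I_N -> R) (c0 : R), admissible blk rho (cost Q) X0 c c0.
Proof.
move=> QT psd hrho; have [C C0 rhoC] := uniform_retraction_bound hrho.
pose K : R := (r * d).+1%:R * C; pose F := Num.sqrt (frob Q Q).
pose B := cost Q X0 + F.
have K0 : 0 <= K by rewrite mulr_ge0.
have F0 : 0 <= F := sqrtr_ge0 _.
have B0 : 0 <= B by rewrite addr_ge0.
(* The factor 2 offsets the 1/2 in [c b / 2], and the summand 1 makes [c b + c0] positive. *)
pose c := 2 * (B * K + F * (K + 1) ^+ 2) + 1.
(* [2 * F] bounds the Euclidean Hessian and [d.+1%:R * B] the curvature term, by [frob_symmx_le]. *)
pose c0 := 2 * F + d.+1%:R * B.
have c_gt0 : 0 < c by rewrite ltr_wpDl // mulr_ge0 // addr_ge0 // mulr_ge0 // sqr_ge0.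
have c00 : 0 <= c0 by rewrite addr_ge0 // mulr_ge0.
exists (fun=> c), c0; split => [_|//|_|X [XM fX] b fb Xb]; first exact: ltW.
  by rewrite ltr_wpDr.
have gE : forall Z V, fb (Z + V) =
    fb Z + dot (redG Q X Z) V + 2^-1 * dot (redA Q V) V
  := @reduced_quadratic _ _ _ _ Q QT _ blk b X.
have GE := @redG_line _ _ _ _ Q _ blk b X.
have AZ := @redAZ _ r _ _ Q _ blk b.
have xM : manifold Xb := @manifold_restr _ _ _ _ _ blk b X XM.
have nG : nrm (redG Q X Xb) <= B.
  by apply: le_trans (@nrm_redG _ _ _ _ Q QT psd _ blk b X) _; rewrite lerD2r.
have nA := @nrm_redA _ r _ _ Q _ blk b; rewrite -/F in nA.
split => [eta t|eta t e1].
  have rhoCb (j : block blk b) := rhoC (val j).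
  have b2 := nrm_retr_sub2 C0 rhoCb xM t.
  have b1 := nrm_retr_sub C0 rhoCb xM t.
  rewrite -/K in b1 b2.
  rewrite /pullback (quadratic_dot_rgrad gE AZ t).
  set W := retr _ Xb eta in b1 b2 *.
  have -> : W = Xb + (W - Xb) by rewrite addrC subrK.
  rewrite gE [dot eta _]dotC.
  set D := W - Xb in b1 b2 *.
  have GD : dot (redG Q X Xb) D = dot (redG Q X Xb) (D - eta) + dot (redG Q X Xb) eta.
    by rewrite -dotDr subrK.
  rewrite GD (_ : fb Xb + (dot (redG Q X Xb) (D - eta) + dot (redG Q X Xb) eta) +
     2^-1 * dot (redA Q D) D - (fb Xb + dot (redG Q X Xb) eta) =
     dot (redG Q X Xb) (D - eta) + 2^-1 * dot (redA Q D) D); last by ring.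
  apply: le_trans (ler_normD _ _) _.
  have h1 : `|dot (redG Q X Xb) (D - eta)| <= B * (K * nrm eta ^+ 2).
    apply: le_trans (dot_CauchySchwarz _ _) _.
    by apply: ler_pM; rewrite ?nrm_ge0.
  have h2 : `|dot (redA Q D) D| <= 2 * F * nrm D ^+ 2.
    apply: le_trans (dot_CauchySchwarz _ _) _.
    by rewrite expr2 mulrA ler_wpM2r ?nrm_ge0 // nA.
  have h3 : nrm D ^+ 2 <= (K + 1) ^+ 2 * nrm eta ^+ 2.
    rewrite -exprMn lerXn2r ?nnegrE ?nrm_ge0 // mulr_ge0 ?nrm_ge0 //.
    by rewrite addr_ge0.
  have h4 : F * nrm D ^+ 2 <= F * ((K + 1) ^+ 2 * nrm eta ^+ 2) by rewrite ler_wpM2l.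
  rewrite normrM ger0_norm ?invr_ge0 // /c.
  have := sqr_ge0 (nrm eta).
  move: h1 h2 h4; set u := nrm eta ^+ 2; set v := nrm D ^+ 2; set w := (K + 1) ^+ 2.
  lra.
rewrite (quadratic_dot_rhess gE GE AZ t).
apply: le_trans (ler_normB _ _) _; apply: lerD.
  apply: le_trans (dot_CauchySchwarz _ _) _.
  rewrite -[leRHS]mul1r; apply: ler_pM; rewrite ?nrm_ge0 //.
  by apply: le_trans (nA eta) _; rewrite ler_piMr // mulr_ge0.
apply: le_trans (ler_norm_sum _ _ _) _.
apply: (@le_trans _ _ (\sum_i frob (eta i) (eta i) * (d.+1%:R * B))); last first.
  rewrite -mulr_suml -/(dot eta eta) -sqr_nrm -[leRHS]mul1r ler_wpM2r ?mulr_ge0 //.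
  by rewrite expr_le1 // nrm_ge0.
apply: ler_sum => i _.
set V := lsubmx (eta i); set S := symmx _ _.
have VV : frob V V <= frob (eta i) (eta i).
  by rewrite (frob_hsubmx (eta i)) lerDl frob_ge0.
apply: (@le_trans _ _ (frob V V * (d.+1%:R * B))); last first.
  by rewrite ler_wpM2r // mulr_ge0.
have dB : 0 <= frob V V * (d.+1%:R * B) by rewrite mulr_ge0 ?frob_ge0 // mulr_ge0.
rewrite -ler_sqr ?nnegrE // real_normK ?num_real //.
apply: le_trans (frob_CauchySchwarz _ _) _.
rewrite exprMn expr2 -mulrA ler_wpM2l ?frob_ge0 //.
apply: le_trans (frob_mulmx _ _) _; rewrite ler_wpM2l ?frob_ge0 //.
apply: le_trans (frob_symmx_le _ (xM i)) _.
have GB : frob (lsubmx (redG Q X Xb i)) (lsubmx (redG Q X Xb i)) <= B ^+ 2.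
  apply: (@le_trans _ _ (nrm (redG Q X Xb) ^+ 2)); last first.
    by rewrite lerXn2r ?nnegrE ?nrm_ge0.
  rewrite sqr_nrm /dot (bigD1 i) //= (frob_hsubmx (redG Q X Xb i)) -addrA lerDl.
  by rewrite addr_ge0 ?frob_ge0 // sumr_ge0 // => j _; exact: frob_ge0.
rewrite exprMn; apply: ler_pM; rewrite ?frob_ge0 //.
by rewrite -natrX ler_nat; exact: leq_sqrS.
Qed.

(** * Trust regions *)

Section TrustRegionArithmetic.
Variables (R : realType) (a D c c0 : R).
Hypotheses (a0 : 0 < a) (D0 : 0 < D) (cp : 0 <= c).
Hypothesis L_gt0 : 0 < c + c0.

Let lam : R := 1 / (8 * (c + c0)).

Let lam_gt0 : 0 < lam.
Proof. by rewrite divr_gt0 // mulr_gt0. Qed.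

Let lamL : lam * (c + c0) = 8^-1.
Proof. by rewrite /lam; field; rewrite lt0r_neq0. Qed.

(* [F], [M] and [P] stand for the values of the cost at the current point, and
   of the model and of the pullback at a step of squared length [n2]. *)
Variables F M P n2 : R.
Hypotheses (n2D : n2 <= D ^+ 2) (PM : P <= M + (c + c0) / 2 * n2).

Let PMD : P <= M + 2^-1 * (D * (D * (c + c0))).
Proof.
apply: le_trans PM _; rewrite lerD2l.
have : (c + c0) / 2 * n2 <= (c + c0) / 2 * D ^+ 2.
  by rewrite ler_wpM2l // divr_ge0 // ltW.
rewrite expr2; lra.
Qed.

Let c0D : c0 * D ^+ 2 <= D * (D * (c + c0)).
Proof.
have : c0 * D ^+ 2 <= (c + c0) * D ^+ 2 by rewrite ler_wpM2r ?sqr_ge0 // lerDr.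
rewrite expr2; lra.
Qed.

(** As [lam * (c + c0) = 1/8], the radius satisfies [D (c + c0) < 3/4 a]. So the model decreases by
    more than 5/8 of [D a], with an error below 3/8 of [D a]: the ratio exceeds 2/5. *)
Lemma ratio_gt_quarter : D < 6 * lam * a -> D * a - c0 / 2 * D ^+ 2 <= F - M ->
  4^-1 < (F - P) / (F - M).
Proof.
move=> Dlt dm.
have DL : D * (c + c0) < 3 / 4 * a.
  have : D * (c + c0) < 6 * lam * a * (c + c0) by rewrite ltr_pM2r.
  have E l : 6 * l * a * (c + c0) = 6 * (l * (c + c0)) * a by ring.
  by rewrite E lamL; lra.
have DDL : D * (D * (c + c0)) < D * (3 / 4 * a) by rewrite ltr_pM2l.
have Da : 0 < D * a by rewrite mulr_gt0.
move: PMD c0D => PMD' c0D'.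
have dmp : 5 / 8 * (D * a) < F - M by lra.
rewrite ltr_pdivlMr; lra.
Qed.

(** Now [D (c + c0) <= 3/16 a]: the model decreases by at least 29/32 of [D a] with an error of at
    most 3/32 of [D a], and [D a >= lam a^2]. *)
Lemma short_step_decrease : lam * a <= D -> D <= 3 / 2 * lam * a ->
  D * a - c0 / 2 * D ^+ 2 <= F - M -> P <= F - lam / 4 * a ^+ 2.
Proof.
move=> lD Dle dm.
have DL : D * (c + c0) <= 3 / 16 * a.
  have : D * (c + c0) <= 3 / 2 * lam * a * (c + c0) by rewrite ler_pM2r.
  have E l : 3 / 2 * l * a * (c + c0) = 3 / 2 * (l * (c + c0)) * a by ring.
  by rewrite E lamL; lra.
have DDL : D * (D * (c + c0)) <= D * (3 / 16 * a) by rewrite ler_wpM2l // ltW.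
have Da : lam * a * a <= D * a by rewrite ler_pM2r.
have Dap : 0 < D * a by rewrite mulr_gt0.
have laa l : l / 4 * a ^+ 2 = 4^-1 * (l * a * a) by ring.
move: PMD c0D => PMD' c0D'; rewrite laa; lra.
Qed.

(** The model decrease is that of the gradient ray at length [3/2 lam a]. Since [lam c0 <= 1/8], it
    is at least [(3/2 - 9/64) lam a^2], hence at least [lam a^2], and an accepted step realizes a
    quarter of it. This estimate at length [lam a] would only give [15/16 lam a^2]. *)
Lemma long_step_decrease : 4^-1 < (F - P) / (F - M) ->
  3 / 2 * lam * a ^+ 2 - c0 / 2 * (3 / 2 * lam * a) ^+ 2 <= F - M ->
  P <= F - lam / 4 * a ^+ 2.
Proof.
move=> acc dm.
have laa0 : 0 < lam * a ^+ 2 by rewrite mulr_gt0 // exprn_gt0.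
have lc : lam * c0 <= 8^-1 by rewrite -lamL ler_wpM2l ?lerDr // ltW.
have c1 : lam * c0 * (lam * a ^+ 2) <= 8^-1 * (lam * a ^+ 2).
  by rewrite ler_wpM2r // ltW.
have e1 l : (3 / 2 * l * a) ^+ 2 = 9 / 4 * (l * (l * a ^+ 2)) by field.
have e2 l : 3 / 2 * l * a ^+ 2 = 3 / 2 * (l * a ^+ 2) by ring.
have e3 l : l / 4 * a ^+ 2 = 4^-1 * (l * a ^+ 2) by ring.
have e4 l : c0 / 2 * (9 / 4 * (l * (l * a ^+ 2))) = 9 / 8 * (l * c0 * (l * a ^+ 2)) by field.
rewrite e1 e2 e4 in dm; rewrite e3.
move: (lam * a ^+ 2) (lam * c0 * _) laa0 c1 dm => A B A0 BA dm.
have dmp : A <= F - M by lra.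
have FM : 0 < F - M by lra.
move: acc; rewrite ltr_pdivlMr //; lra.
Qed.

End TrustRegionArithmetic.

Lemma model_decrease_arith (R : realType) (F p q A B : R) :
  p <= q -> q <= F - A + B -> A - B <= F - p.
Proof. lra. Qed.

Lemma model_error_arith (R : realType) (P F q1 q2 c c0 n2 : R) :
  P - (F + q1) <= c / 2 * n2 -> - (c0 * n2) <= q2 ->
  P <= F + q1 + 2^-1 * q2 + (c + c0) / 2 * n2.
Proof. lra. Qed.

Section TrustRegion.
Variables (R : realType) (r d : nat) (I : finType).
Variable rho : I -> 'M[R]_(r, d) -> 'M[R]_(r, d) -> 'M[R]_(r, d).
Variable f : {ffun I -> 'M[R]_(r, d + 1)} -> R.
Variable x : {ffun I -> 'M[R]_(r, d + 1)}.
Implicit Types eta s : {ffun I -> 'M[R]_(r, d + 1)}.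
Hypothesis xM : manifold x.

Notation model := (model f x).
Notation pullback := (pullback rho f x).
Notation a := (nrm (rgrad f x)).

Lemma tr_loop_retr D x' : tr_loop rho f x D x' ->
  exists2 eta, tangent x eta & x' = retr rho x eta.
Proof. by elim=> {}D {}x' eta [tx _ _] _ => [->|//]; exists eta. Qed.

Lemma manifold_retr eta :
  (forall i, smooth_retraction (rho i)) -> tangent x eta ->
  manifold (retr rho x eta).
Proof.
by move=> hrho t i; rewrite ffunE row_mxKl; have [+ _ _ _] := hrho i; apply.
Qed.

Lemma manifold_block_update D x' : (forall i, smooth_retraction (rho i)) ->
  block_update rho f x D x' -> manifold x'.
Proof.
move=> hrho [[_ ->]//|[_ /tr_loop_retr[eta t ->]]].
exact: manifold_retr.
Qed.

Variables (c c0 : R).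
Hypotheses (c_ge0 : 0 <= c) (L_gt0 : 0 < c + c0).
Hypothesis pullback_bound : forall eta, tangent x eta ->
  `|pullback eta - (f x + dot eta (rgrad f x))| <= c / 2 * nrm eta ^+ 2.
Hypothesis hess_bound : forall eta, tangent x eta ->
  `|dot eta (rhess f x eta)| <= c0 * nrm eta ^+ 2.

Let lam : R := 1 / (8 * (c + c0)).

Let lam_gt0 : 0 < lam.
Proof. by rewrite divr_gt0 // mulr_gt0. Qed.

Let lamL : lam * (c + c0) = 8^-1.
Proof. by rewrite /lam; field; rewrite lt0r_neq0. Qed.

Lemma tangent0 : tangent x 0.
Proof. by move=> i; rewrite ffunE linear0; exact: stiefel_tangent0. Qed.

Lemma pullback0 : pullback 0 = f x.
Proof.
have := pullback_bound tangent0.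
have -> : nrm (0 : {ffun I -> 'M[R]_(r, d + 1)}) = 0.
  by rewrite -(scale0r 0) nrmZ normr0 mul0r.
rewrite expr0n mulr0 dotC dot0r addr0 normr_le0 subr_eq0.
by move/eqP.
Qed.

Lemma model0 : model 0 = f x.
Proof. by rewrite /Defs.model dot0r dotC dot0r mulr0 !addr0. Qed.

(** The Cauchy step is at least as good as every point of the gradient ray within the radius. The
    parameter [t] stays free: below it is [D / a], the boundary point, or [3/2 lam]. *)
Lemma cauchy_decrease D eta t : approx_minimizer f x D eta -> 0 <= t -> t * a <= D ->
  t * a ^+ 2 - c0 / 2 * (t * a) ^+ 2 <= model 0 - model eta.
Proof.
case=> _ _ [s [_ [_ smin]] es] t0 tD.
set ray := - (t *: rgrad f x).
have tray : tangent x ray.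
  move=> i; rewrite /ray -scaleNr ffunE linearZ; apply: stiefel_tangentZ.
  exact: tangent_tproj.
have nray : nrm ray = t * a by rewrite nrmN nrmZ ger0_norm.
have := le_trans es (smin t t0 _); rewrite -/ray nray => /(_ tD) le.
have h := hess_bound tray; rewrite nray in h.
have mray : model ray <= f x - t * a ^+ 2 + c0 / 2 * (t * a) ^+ 2.
  have -> : model ray = f x - t * a ^+ 2 + 2^-1 * dot ray (rhess f x ray).
    by rewrite /Defs.model {1}/ray dotNr dotZr sqr_nrm.
  rewrite lerD2l [c0 / 2]mulrC -mulrA ler_pM2l ?invr_gt0 //.
  exact: le_trans (ler_norm _) h.
rewrite model0; exact: model_decrease_arith le mray.
Qed.

Lemma model_error eta : tangent x eta ->
  pullback eta <= model eta + (c + c0) / 2 * nrm eta ^+ 2.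
Proof.
move=> t; have := pullback_bound t; rewrite ler_norml => /andP[_ p].
have := hess_bound t; rewrite ler_norml => /andP[h _].
rewrite /Defs.model [dot (rgrad _ _) eta]dotC.
exact: model_error_arith p h.
Qed.

Lemma not_accepted_radius D eta : 0 < D -> 0 < a ->
  approx_minimizer f x D eta -> ~ accepted rho f x eta -> 6 * lam * a <= D.
Proof.
move=> D0 a0 ap nacc; rewrite leNgt; apply/negP => Dlt; apply: nacc.
case: (ap) => t nD _.
have := cauchy_decrease ap (t := D / a); rewrite divfK ?lt0r_neq0 // lexx.
rewrite (divr_ge0 (ltW D0) (ltW a0)) => /(_ isT isT).
rewrite expr2 mulrA divfK ?lt0r_neq0 // => dm.
have n2 : nrm eta ^+ 2 <= D ^+ 2 by rewrite lerXn2r ?nnegrE ?nrm_ge0 // ltW.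
rewrite /accepted pullback0; rewrite model0 in dm *.

exact: (ratio_gt_quarter a0 D0 c_ge0 L_gt0 n2 (model_error t) Dlt dm).
Qed.

(** A rejection needs [D >= 6 lam a] and divides [D] by 4. The induction is on [k] with
    [D < 4^k * 6 lam a]; for [k = 0] nothing can be rejected. *)
Lemma tr_terminates_gt0 D : 0 < D -> 0 < a -> tr_terminates rho f x D.
Proof.
move=> D0 a0.
have la0 : 0 < 6 * lam * a by rewrite mulr_gt0 // mulr_gt0.
have [k] : exists k : nat, D < 4 ^+ k * (6 * lam * a).
  have [k Dk] : exists k : nat, D / (6 * lam * a) < k%:R.
    by exists (Num.truncn (D / (6 * lam * a))).+1; rewrite truncnS_gt.
  exists k; rewrite -ltr_pdivrMr // (lt_le_trans Dk) // -natrX ler_nat.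
  by rewrite ltnW // ltn_expl.
elim: k D D0 => [|k IH] D D0 Dk; constructor => eta ap nacc.
  by have := not_accepted_radius D0 a0 ap nacc; rewrite expr0 mul1r in Dk; rewrite leNgt Dk.
apply: IH; first by rewrite divr_gt0.
by rewrite ltr_pdivrMr // (lt_le_trans Dk) // exprS -mulrA [leLHS]mulrC.
Qed.

Lemma accepted_decrease D eta : 0 < a -> lam * a <= D ->
  approx_minimizer f x D eta -> accepted rho f x eta ->
  pullback eta <= f x - lam / 4 * a ^+ 2.
Proof.
move=> a0 lD ap acc.
have la0 : 0 < lam * a by rewrite mulr_gt0.
have D0 : 0 < D := lt_le_trans la0 lD.
case: (ap) => t nD _.
have n2 : nrm eta ^+ 2 <= D ^+ 2 by rewrite lerXn2r ?nnegrE ?nrm_ge0 // ltW.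
(* For a small radius the accuracy of the model gives the decrease; for a large one the acceptance
   test does. *)
have [D32|D32] := leP D (3 / 2 * lam * a).
  have := cauchy_decrease ap (t := D / a); rewrite divfK ?lt0r_neq0 // lexx.
  rewrite (divr_ge0 (ltW D0) (ltW a0)) => /(_ isT isT).
  have -> : D / a * a ^+ 2 = D * a by rewrite expr2 mulrA divfK ?lt0r_neq0.
  rewrite model0 => dm.
  exact: (short_step_decrease a0 D0 c_ge0 L_gt0 n2 (model_error t) lD D32 dm).
have := cauchy_decrease ap (t := 3 / 2 * lam).
rewrite (mulr_ge0 _ (ltW lam_gt0)) ?divr_ge0 // (ltW D32) => /(_ isT isT) dm.
move: acc; rewrite /accepted pullback0; rewrite model0 in dm * => acc.
exact: (long_step_decrease a0 c_ge0 L_gt0 acc dm).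
Qed.

(** [lam a <= D] is an invariant of the loop: a rejection forces [D >= 6 lam a], so [D / 4] is still
    at least [lam a]. *)
Lemma tr_loop_decrease D x' : 0 < a -> lam * a <= D -> tr_loop rho f x D x' ->
  f x' <= f x - lam / 4 * a ^+ 2.
Proof.
move=> a0 lD H; elim: H lD => {}D {}x' eta ap acc.
  by move=> -> lD; exact: (accepted_decrease a0 lD ap acc).
move=> _ IH lD; apply: IH.
have D0 : 0 < D by apply: lt_le_trans lD; rewrite mulr_gt0.
have := not_accepted_radius D0 a0 ap acc.
have : 0 < lam * a by rewrite mulr_gt0.
lra.
Qed.

Lemma block_update_decrease D x' : lam * a <= D -> block_update rho f x D x' ->
  f x' <= f x - lam / 4 * a ^+ 2.
Proof.
move=> lD [[g0 ->]|[/nrm_gt0 a0]]; last exact: tr_loop_decrease.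
by rewrite g0 sqr_nrm dot0r mulr0 subr0.
Qed.

End TrustRegion.

(** * Convergence rates *)

Section Averaging.
Variables (R : realType) (N : nat).

Lemma min_upto_sum (K : nat) (u : nat -> R) :
  K%:R * min_upto K u <= \sum_(k < K) u k.
Proof.
rewrite mulr_natl -[X in _ *+ X]card_ord -sumr_const.
by apply: ler_sum => k _; exact: bigmin_le.
Qed.

(** Telescoping, and the minimum is at most the average. Here [e k] stands for the cost at iteration
    [k] or its expectation, and [a k] likewise for the squared gradient norm. *)
Lemma rate_of_descent (e a : nat -> R) (C F0 Fs : R) (K : nat) :
  0 < C -> (0 < N)%N -> (0 < K)%N ->
  (forall k, e k.+1 <= e k - C / N%:R * a k) -> e 0%N <= F0 -> Fs <= e K ->
  min_upto K a <= N%:R * (F0 - Fs) / (C * K%:R).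
Proof.
move=> C0 N0 K0 desc eF Fe.
have tele k : C / N%:R * \sum_(i < k) a i <= e 0%N - e k.
  elim: k => [|k IH]; first by rewrite big_ord0 mulr0 subrr.
  by rewrite big_ord_recr mulrDr /=; have := desc k; lra.
have Np : 0 < N%:R :> R by rewrite ltr0n.
have Kp : 0 < K%:R :> R by rewrite ltr0n.
have CN : 0 < C / N%:R by rewrite divr_gt0.
have le : C / N%:R * (K%:R * min_upto K a) <= F0 - Fs.
  apply: (@le_trans _ _ (e 0%N - e K)); last by lra.
  by apply: le_trans (tele K); rewrite ler_pM2l // min_upto_sum.
rewrite ler_pdivlMr ?mulr_gt0 //.
have -> : min_upto K a * (C * K%:R) = N%:R * (C / N%:R * (K%:R * min_upto K a)).
  by field; rewrite lt0r_neq0.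
by rewrite ler_pM2l.
Qed.

(** [prob] recurses from the first selection whereas runs grow at the end, hence the induction over
    an arbitrary prefix. *)
Lemma prob_rcons (p : seq 'I_N -> 'I_N -> R) h b :
  prob p (rcons h b) = prob p h * p h b.
Proof.
pose go := fix go (pre h : seq 'I_N) {struct h} : R :=
  if h is b' :: h' then p pre b' * go (rcons pre b') h' else 1.
suff H pre : go pre (rcons h b) = go pre h * p (pre ++ h) b by exact: H.
elim: h pre => [|b' h IH] pre /=; first by rewrite cats0 mulr1 mul1r.
by rewrite IH cat_rcons mulrA.
Qed.

Lemma expect0 (p : seq 'I_N -> 'I_N -> R) u : expect p 0 u = u [::].
Proof.
rewrite /expect (big_pred1 [tuple]) => [|t]; last by rewrite [t]tuple0 /= eqxx.
by rewrite mul1r.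
Qed.

(** The tower property: histories of length [k.+1] are reindexed as a history of length [k] and a
    last selection. *)
Lemma expectS (p : seq 'I_N -> 'I_N -> R) k u :
  expect p k.+1 u =
  expect p k (fun h => \sum_b p h b * u (rcons h b)).
Proof.
pose g (q : k.-tuple 'I_N * 'I_N) : k.+1.-tuple 'I_N := [tuple of rcons q.1 q.2].
have gbij : bijective g.
  apply: inj_card_bij => [[h b] [h' b'] /(congr1 val) /= /rcons_inj[hh bb]|].
    by rewrite bb (val_inj hh).
  by rewrite card_prod !card_tuple card_ord expnSr.
rewrite /expect (reindex g) /=; last exact: onW_bij.
rewrite -(pair_bigA _ (fun (h : k.-tuple 'I_N) b => prob p (rcons h b) * u (rcons h b))) /=.
apply: eq_bigr => h _; rewrite mulr_sumr; apply: eq_bigr => b _.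
by rewrite prob_rcons mulrA.
Qed.

Variable p : seq 'I_N -> 'I_N -> R.
Hypotheses (p_ge0 : forall h b, 0 <= p h b) (p_sum1 : forall h, \sum_b p h b = 1).

Lemma prob_ge0 h : 0 <= prob p h.
Proof.
by elim/last_ind: h => [|h b IH]; rewrite ?prob_rcons ?mulr_ge0 // ler01.
Qed.

Lemma prob_gt0_rcons h b : 0 < prob p (rcons h b) -> 0 < prob p h.
Proof.
rewrite prob_rcons !lt_neqAle prob_ge0 andbT => /andP[+ _].
by apply: contraNneq => <-; rewrite mul0r.
Qed.

(** The comparison is asked only on histories of positive probability, since a random run is
    unconstrained on the others. *)
Lemma expect_le k u v : (forall h, 0 < prob p h -> u h <= v h) ->
  expect p k u <= expect p k v.
Proof.
move=> uv; apply: ler_sum => h _; have [h0|h0|<-] := ltgtP 0 (prob p h).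
- by rewrite ler_pM2l // uv.
- by have := prob_ge0 h; rewrite leNgt h0.
- by rewrite !mul0r.
Qed.

Lemma expect_cst k (C : R) : expect p k (fun=> C) = C.
Proof.
elim: k => [|k IH]; first by rewrite expect0.
rewrite expectS -[RHS]IH; apply: eq_bigr => h _.
by rewrite -mulr_suml p_sum1 mul1r.
Qed.

Lemma expect_lin k u v (t : R) :
  expect p k (fun h => u h - t * v h) = expect p k u - t * expect p k v.
Proof.
rewrite mulr_sumr -sumrB; apply: eq_bigr => h _.
by rewrite mulrBr mulrCA.
Qed.

End Averaging.

(** * Rates for any algorithm whose steps decrease the cost sufficiently *)

Section Rates.
Variables (R : realType) (r d n N : nat) (blk : 'I_n -> 'I_N).
Variable f : {ffun 'I_n -> 'M[R]_(r, d + 1)} -> R.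
Variable X0 : {ffun 'I_n -> 'M[R]_(r, d + 1)}.
Variables (S : Type) (step : S -> 'I_N -> S -> Prop) (s0 : S).
Variable cur : S -> {ffun 'I_n -> 'M[R]_(r, d + 1)}.
Variables (C Fs : R).
Hypotheses (C_gt0 : 0 < C) (N_gt0 : (0 < N)%N).
Hypotheses (cur0 : cur s0 = X0) (X0M : manifold X0).
Hypothesis Fs_le : forall X, manifold X -> Fs <= f X.
Hypothesis step_descent : forall s b s', sublevel f X0 (cur s) -> step s b s' ->
  manifold (cur s') /\
  f (cur s') <= f (cur s) - C * nrm (grad_block blk f b (cur s)) ^+ 2.

Notation g b s := (nrm (grad_block blk f b (cur s)) ^+ 2).

Let sublevel0 : sublevel f X0 (cur s0).
Proof. by rewrite cur0. Qed.

Let step_sublevel s b s' : sublevel f X0 (cur s) -> step s b s' ->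
  sublevel f X0 (cur s').
Proof.
move=> sX st; have [M le] := step_descent sX st; split => //.
case: sX => _ le0; apply: le_trans le _; apply: le_trans le0.
by rewrite gerBl mulr_ge0 ?sqr_ge0 // ltW.
Qed.

Lemma descent_stays : stays_in_sublevel f X0 step s0 cur.
Proof.
move=> b s [s00 st]; elim=> [|k IH]; first by rewrite s00.
exact: step_sublevel (st k).
Qed.

Lemma descent_greedy_rate :
  greedy_rate blk f step s0 cur (fun K => N%:R * (f X0 - Fs) / (C * K%:R)).
Proof.
move=> b s run gr K K0; have [s00 st] := run.
have sub := descent_stays run.
apply: (@rate_of_descent _ _ (fun k => f (cur (s k)))) => //= [k||].
- have [_ le] := step_descent (sub k) (st k); apply: le_trans le _.
  (* The squared gradient norm is the sum over [N] blocks, each term at most that of the selected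
     block. *)
  rewrite lerD2l lerN2 -mulrA ler_pM2l // mulrC ler_pdivrMr ?ltr0n //.
  rewrite -(sum_sqr_nrm_restr blk) mulr_natr -[X in _ *+ X]card_ord -sumr_const.
  by apply: ler_sum => b' _; exact: gr.
- by rewrite s00 cur0.
- by apply: Fs_le; case: (sub K).
Qed.

Lemma descent_random_rate :
  random_rate blk f step s0 cur (fun K => N%:R * (f X0 - Fs) / (C * K%:R)).
Proof.
move=> p s [s00 st] sel K K0.
have Np : 0 < N%:R :> R by rewrite ltr0n.
(* Both selection rules enter only through [pg]: the expected squared norm of the selected block
   gradient is at least the average over the blocks. *)
have [p0 p1 pg] : [/\ forall h b, 0 <= p h b, forall h, \sum_b p h b = 1
    & forall h, N%:R^-1 * \sum_b g b (s h) <= \sum_b p h b * g b (s h)].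
  case: sel => [un|im].
    split=> [h b|h|h]; first by rewrite un invr_ge0.
      under eq_bigr do rewrite un.
      by rewrite sumr_const card_ord -[LHS]mulr_natl mulfV // lt0r_neq0.
    by under [leRHS]eq_bigr do rewrite un; rewrite -mulr_sumr.
  split=> [h b|h|h]; try by case: (im h).
  have [_ _ pg] := im h; set G := \sum_b g b (s h) in pg *.
  have [G0|Gn0] := eqVneq G 0.
    rewrite G0 mulr0; apply: sumr_ge0 => b _; rewrite mulr_ge0 ?sqr_ge0 //.
    by case: (im h).
  have Gp : 0 < G.
    by rewrite lt_neqAle eq_sym Gn0; apply: sumr_ge0 => b _; rewrite sqr_ge0.
  (* Multiplied by [G], the claim says that [G^2 / N] is at most the sum of the squares of the terms
     of [G]: Cauchy-Schwarz against the constant 1. *)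
  rewrite -(ler_pM2r Gp) mulr_suml.
  under eq_bigr do rewrite mulrAC pg -expr2.
  rewrite -mulrA ler_pdivrMl // -expr2.
  have := sum_CauchySchwarz (fun b => g b (s h)) (fun=> 1).
  have -> : \sum_b g b (s h) * 1 = G by apply: eq_bigr => b _; rewrite mulr1.
  by rewrite expr1n sumr_const card_ord mulrC.
have sub h : 0 < prob p h -> sublevel f X0 (cur (s h)).
  elim/last_ind: h => [_|h b IH hb]; first by rewrite s00.
  by apply: step_sublevel (st _ _ hb); exact/IH/(prob_gt0_rcons p0)/hb.
apply: (@rate_of_descent _ _ (fun k => expect p k (fun h => f (cur (s h))))) => //= [k||].
- rewrite expectS -expect_lin; apply: expect_le => // h h0.
  apply: (@le_trans _ _ (\sum_b p h b * (f (cur (s h)) - C * g b (s h)))).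
    (* The step relation is available only for [p h b > 0]; for [p h b = 0] both terms vanish. *)
    apply: ler_sum => b _; have [b0|b0|<-] := ltgtP 0 (p h b).
    + rewrite ler_pM2l //; have hb : 0 < prob p (rcons h b).
        by rewrite prob_rcons mulr_gt0.
      by have [] := step_descent (sub _ h0) (st _ _ hb).
    + by have := p0 h b; rewrite leNgt b0.
    + by rewrite !mul0r.
  under eq_bigr do rewrite mulrBr mulrCA.
  rewrite sumrB -mulr_suml p1 mul1r -mulr_sumr lerD2l lerN2 -mulrA ler_pM2l //.
  by rewrite -(sum_sqr_nrm_restr blk); exact: pg.
- by rewrite expect0 s00 cur0.
- rewrite -[leLHS](expect_cst p1 K); apply: expect_le => // h /sub[M _].
  exact: Fs_le.
Qed.

End Rates.

(** * Decrease and termination of BlockUpdate on the sublevel set *)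

Section Calls.
Variables (R : realType) (r d n N : nat) (blk : 'I_n -> 'I_N).
Variable rho : 'I_n -> 'M[R]_(r, d) -> 'M[R]_(r, d) -> 'M[R]_(r, d).
Variable Q : 'M[R]_(\sum_(i < n) (d + 1)).
Variable X0 : {ffun 'I_n -> 'M[R]_(r, d + 1)}.
Hypothesis hrho : forall i : 'I_n, smooth_retraction (rho i).
Variables (c : 'I_N -> R) (c0 : R).
Hypothesis QT : Q^T = Q.
Hypothesis adm : admissible blk rho (cost Q) X0 c c0.
Let lam : 'I_N -> R := fun b => 1 / (8 * (c b + c0)).

Lemma call_manifold D b X X' : manifold X ->
  call blk rho (cost Q) lam D b X X' -> manifold X'.
Proof.
move=> XM [_ [z bz ->]]; apply: manifold_merge => //.
apply: manifold_block_update bz; first exact: manifold_restr.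
by move=> j; exact: hrho.
Qed.

(** The bound on the unit ball in [admissible], rescaled by homogeneity of the Hessian form. *)
Let hess_bound b X eta : sublevel (cost Q) X0 X -> tangent (restr blk b X) eta ->
  `|dot eta (rhess (reduced blk (cost Q) b X) (restr blk b X) eta)|
    <= c0 * nrm eta ^+ 2.
Proof.
move=> sX t; have [_ _ _ /(_ X sX b)[_ H]] := adm.
have [e0|en0] := eqVneq (nrm eta) 0.
  by rewrite (nrm_eq0 e0) dotC dot0r normr0 -(nrm_eq0 e0) e0 expr0n mulr0.
have ep : 0 < nrm eta by rewrite lt_neqAle eq_sym en0 nrm_ge0.
have tZ : tangent (restr blk b X) ((nrm eta)^-1 *: eta).
  by move=> j; rewrite [(_ *: eta) j]ffunE linearZ; exact/stiefel_tangentZ/t.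
have := H _ tZ.
have gE := @reduced_quadratic _ _ _ _ Q QT _ blk b X.
have GE := @redG_line _ r _ _ Q _ blk b X.
have AZ := @redAZ _ r _ _ Q _ blk b.
rewrite nrmZ ger0_norm ?invr_ge0 ?nrm_ge0 // mulVf // => /(_ (lexx _)).
rewrite (quadratic_dot_rhessZ gE GE AZ) // normrM ger0_norm ?sqr_ge0 //.
by rewrite exprVn ler_pdivrMl ?exprn_gt0 // mulrC.
Qed.

Lemma call_descent D b X X' : sublevel (cost Q) X0 X ->
  call blk rho (cost Q) lam D b X X' ->
  cost Q X' <= cost Q X - lam b / 4 * nrm (grad_block blk (cost Q) b X) ^+ 2.
Proof.
move=> sX [lD [z bz ->]]; have [XM _] := sX.
have [cge _ cc0 /(_ X sX b)[H _]] := adm.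
rewrite -(reduced_rgrad QT blk b X) -(reduced_restr Q blk b X).
apply: (block_update_decrease (manifold_restr XM) (cge b) (cc0 b) H _ lD bz).
by move=> eta t; exact: hess_bound.
Qed.

Lemma sublevel_terminates D b X : 0 < D -> sublevel (cost Q) X0 X ->
  terminates_at blk rho (cost Q) D b X.
Proof.
move=> D0 sX /nrm_gt0 a0; have [XM _] := sX.
have [cge _ cc0 /(_ X sX b)[H _]] := adm.
apply: (tr_terminates_gt0 (manifold_restr XM) (cge b) (cc0 b) H _ D0 a0).
by move=> eta t; exact: hess_bound.
Qed.

End Calls.

Theorem mainTheorem4 (R : realType) (d n N r : nat)
    (G : pose_graph R d n) (Q : 'M[R]_(\sum_(i < n) (d + 1)))
    (blk : 'I_n -> 'I_N)
    (rho : 'I_n -> 'M[R]_(r, d) -> 'M[R]_(r, d) -> 'M[R]_(r, d))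
    (X0 : {ffun 'I_n -> 'M[R]_(r, d + 1)})
    (hd : d = 2%N \/ d = 3%N) (hn : (0 < n)%N) (hr : (d <= r)%N)
    (hQ : is_connection_laplacian G Q)
    (hblk : forall b : 'I_N, exists i : 'I_n, blk i = b)
    (hrho : forall i : 'I_n, smooth_retraction (rho i))
    (hX0 : manifold X0) :
  let f : {ffun 'I_n -> 'M[R]_(r, d + 1)} -> R := cost Q in
  let fstar : R := inf [set f X | X in @manifold R r d 'I_n] in
  (exists (c : 'I_N -> R) (c0 : R), admissible blk rho f X0 c c0) /\
  (forall (c : 'I_N -> R) (c0 : R), admissible blk rho f X0 c c0 ->
   forall (Delta0 c1 : R), 0 < Delta0 -> 0 < c1 ->
   let lam : 'I_N -> R := fun b => 1 / (8 * (c b + c0)) in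
   (* the default value of the minimum is itself one of the values lam b *)
   let lam_min : R := \big[Num.min/lam (blk (Ordinal hn))]_(b < N) lam b in
   let C : R := Num.min c1 (lam_min / 4) in
   let rbcd := rbcd_step blk rho f lam Delta0 in
   let rbcdpp := rbcdpp_step blk rho f c1 lam Delta0 in
   let rbcd_bound (K : nat) : R :=
     4 * N%:R * (f X0 - fstar) / (K%:R * lam_min) in
   let rbcdpp_bound (K : nat) : R :=
     N%:R * (f X0 - fstar) / (C * K%:R) in
   (forall X, sublevel f X0 X ->
      forall b : 'I_N, terminates_at blk rho f Delta0 b X) /\
   [/\ stays_in_sublevel f X0 rbcd X0 id,
       greedy_rate blk f rbcd X0 id rbcd_bound
     & random_rate blk f rbcd X0 id rbcd_bound] /\
   [/\ stays_in_sublevel f X0 rbcdpp (pp_init X0) (@pp_X R r d n),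
       greedy_rate blk f rbcdpp (pp_init X0) (@pp_X R r d n) rbcdpp_bound
     & random_rate blk f rbcdpp (pp_init X0) (@pp_X R r d n) rbcdpp_bound]).
Proof.
move=> f fstar; have [QT costE] := hQ.
have psd (X : {ffun 'I_n -> 'M[R]_(r, d + 1)}) : 0 <= cost Q X.
  rewrite /cost costE; apply: sumr_ge0 => e ee; apply: addr_ge0.
    by rewrite mulr_ge0 ?frob_ge0 // ltW // kappa_gt0.
  by rewrite mulr_ge0 ?frob_ge0 // ltW // tau_gt0.
split=> [|c c0 adm Delta0 c1 D0 c10 lam lam_min C rbcd rbcdpp rbcd_bound rbcdpp_bound].
  exact: admissible_exists.
have N0 : (0 < N)%N by case: (blk (Ordinal hn)) => m /(leq_trans _); apply.
(* The infimum is a lower bound because the costs are bounded below by 0. *)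
have Fs_le X : manifold X -> fstar <= f X.
  move=> XM; apply: ge_inf; last by exists X.
  by exists 0 => _ [Z _ <-]; exact: psd.
have [_ _ Lgt0 _] := adm.
have lam_gt0 b : 0 < lam b by rewrite divr_gt0 // mulr_gt0.
have lam_min_gt0 : 0 < lam_min by apply: lt_bigmin.
have lam_min_le b : lam_min / 4 <= lam b / 4.
  by rewrite ler_pM2r ?invr_gt0 //; exact: bigmin_le.
have C_gt0 : 0 < C by rewrite lt_min c10 divr_gt0.
have sublevel0 : sublevel f X0 X0 by split.
have rbcd_descent X b X' : sublevel f X0 X -> rbcd X b X' ->
    manifold X' /\ f X' <= f X - lam_min / 4 * nrm (grad_block blk f b X) ^+ 2.
  move=> sX st; split; first by apply: (call_manifold hrho) st; case: sX.
  apply: le_trans (call_descent QT adm sX st) _.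
  rewrite lerD2l lerN2; apply: ler_wpM2r; first exact: sqr_ge0.
  exact: lam_min_le.
have rbcdpp_descent s b s' : sublevel f X0 (pp_X s) -> rbcdpp s b s' ->
    manifold (pp_X s') /\ f (pp_X s') <=
      f (pp_X s) - C * nrm (grad_block blk f b (pp_X s)) ^+ 2.
  (* After a restart the update is a call at the current point, which gives [lam_min / 4]. Otherwise
     the test itself states a decrease with constant [c1], and the call at [Y] puts the new point on
     the manifold. *)
  move=> sX [Y [X1 [V1 [[YM _] cY _]]]].
  case: ltP => [_ [cX _ _]|dec ->] /=.
    have [M le] := rbcd_descent _ _ _ sX cX; split => //.
    apply: le_trans le _; rewrite lerD2l lerN2 ler_wpM2r ?sqr_ge0 //.
    by rewrite ge_min lexx orbT.
  split; first exact: (call_manifold hrho YM cY).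
  rewrite lerBrDr addrC -lerBrDr; apply: le_trans dec.
  by rewrite ler_wpM2r ?sqr_ge0 // ge_min lexx.
have l4 : 0 < lam_min / 4 by rewrite divr_gt0.
have boundE : rbcd_bound = fun K => N%:R * (f X0 - fstar) / (lam_min / 4 * K%:R).
  (* The equality is one of functions, so [K = 0] occurs; there both sides are 0, as the inverse of
     0 is 0. *)
  apply/funext => K; rewrite /rbcd_bound; have [->|K0] := eqVneq K 0%N.
    by rewrite mul0r mulr0 !invr0 !mulr0.
  by field; rewrite pnatr_eq0 K0 lt0r_neq0.
split; first by move=> X sX b; exact: (sublevel_terminates QT adm).
split; split.
- exact: (@descent_stays R r d n N blk f X0 _ rbcd X0 id _ l4 erefl hX0 rbcd_descent).
- rewrite boundE.
  exact: (@descent_greedy_rate R r d n N blk f X0 _ rbcd X0 id _ _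
    l4 N0 erefl hX0 Fs_le rbcd_descent).
- rewrite boundE.
  exact: (@descent_random_rate R r d n N blk f X0 _ rbcd X0 id _ _
    l4 N0 erefl hX0 Fs_le rbcd_descent).
- exact: (@descent_stays R r d n N blk f X0 _ rbcdpp (pp_init X0) (@pp_X R r d n) _
    C_gt0 erefl hX0 rbcdpp_descent).
- exact: (@descent_greedy_rate R r d n N blk f X0 _ rbcdpp (pp_init X0) (@pp_X R r d n) _ _
    C_gt0 N0 erefl hX0 Fs_le rbcdpp_descent).
- exact: (@descent_random_rate R r d n N blk f X0 _ rbcdpp (pp_init X0) (@pp_X R r d n) _ _
    C_gt0 N0 erefl hX0 Fs_le rbcdpp_descent).
Qed.
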